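(* Let $\alpha_2\in\mathbb{C}$ and consider a system of first-order ordinary differential equations $$\frac{dx}{dt}=f_1,\ \frac{dy}{dt}=f_2,\ \frac{dz}{dt}=f_3,\ \frac{dw}{dt}=f_4,\ \frac{dq}{dt}=f_5,\qquad f_i\in\mathbb{C}(t)[x,y,z,w,q]\ (i=1,\dots,5).$$ Assume: (A1) $\deg f_i=2$ with respect to $x,y,z,w,q$; (A2) in each of the following coordinate systems $r_i:(x_i,y_i,z_i,w_i,q_i)$, $i=1,2,3$, the transformed system has right-hand sides that are polynomials in $x_i,y_i,z_i,w_i,q_i$: $$r_1:\ (x_1,y_1,z_1,w_1,q_1)=\left(x,\,y,\,z,\,-\left(wq+\tfrac12(2\alpha_2-1)\right)q,\,\tfrac1q\right),$$ $$r_2:\ (x_2,y_2,z_2,w_2,q_2)=\left(x+\tfrac q2,\,y+\tfrac{q^2}{4},\,z-\tfrac14q(q^2+8y),\,-\left(\left(w+\tfrac t2-4y^2+q(yq-2z)\right)q-\tfrac12-\alpha_2\right)q,\,\tfrac1q\right),$$ $$r_3:\ x_3=\frac1x,\quad y_3=\frac yx+x,\quad w_3=\frac w{x^2},\quad q_3=qx^2+\frac34x(x^2-2y)+\frac{w-y^2}{4x},$$ $$z_3=-x^3z-\frac1{64}y(4t+5w-35y^2)-\frac1{16}x(4wq+2\alpha_2+1)+\frac{3y(y^2-w)^2}{128x^4}-\frac{105}{128}x^4y-\frac7{128}x^6-\frac3{64}x^2(4t+15w-35y^2)+\frac{(w-21y^2)(w-y^2)}{128x^2}.$$ Then the system coincides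 with $$\frac{dx}{dt}=y+g(t)\ (g(t)\in\mathbb{C}(t)),\quad \frac{dy}{dt}=z,\quad \frac{dz}{dt}=-6y^2+w+\frac t4,\quad \frac{dw}{dt}=wq+\frac{2\alpha_2-1}{4},\quad \frac{dq}{dt}=-\frac12q^2-4y .$$ *)

(* Defs.v *)
From HB Require Import structures.
From mathcomp Require Import all_boot all_algebra.
From mathcomp.real_closed Require Import complex.
From mathcomp Require Import Rstruct.
From mathcomp Require Import mpoly.

Set Implicit Arguments.
Unset Strict Implicit.
Unset Printing Implicit Defensive.

Import GRing.Theory.
Local Open Scope ring_scope.

Local Notation "x %:F" := (@FracField.tofrac _ x).

Definition C : Type := complex Rdefinitions.R.
Definition K := {fraction {poly C}}.
(* polynomial ring K[x,y,z,w,q] : variables 'X_0 = x, 'X_1 = y, 'X_2 = z, 'X_3 = w, 'X_4 = q *)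
Definition MP := {mpoly K[5]}.
Definition L := {fraction MP}.

(* for u = n/d (any representative), du/dt = (n' d - n d') / d^2 *)
Definition derK (u : K) : K :=
  let r := repr u in
  ((\n_r)^`() * \d_r - \n_r * (\d_r)^`())%:F / ((\d_r) ^+ 2)%:F.

Definition tK : K := ('X)%:F.
Definition cK (a : C) : K := (a%:P)%:F.

(* the system dx/dt = f_0, dy/dt = f_1, dz/dt = f_2, dw/dt = f_3, dq/dt = f_4
   with f : 'I_5 -> K[x,y,z,w,q] defines the derivation d/dt on K[x,y,z,w,q]:
   dP/dt = (coefficientwise d/dt of P) + sum_i (dP/dX_i) f_i *)
Definition mpD (f : 'I_5 -> MP) (P : MP) : MP :=
  map_mpoly derK P + \sum_(i < 5) P^`M(i) * f i.

Definition derL (f : 'I_5 -> MP) (u : L) : L :=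
  let r := repr u in
  (mpD f (\n_r) * \d_r - \n_r * mpD f (\d_r))%:F / ((\d_r) ^+ 2)%:F.

Definition var (k : nat) : MP := 'X_(inord k).
Definition varL (k : nat) : L := (var k)%:F.
Definition cL (c : K) : L := (c%:MP)%:F.

Definition vec5 (a b c d e : L) : 'I_5 -> L :=
  fun i => nth 0 [:: a; b; c; d; e] i.

Definition evalL (P : MP) (u : 'I_5 -> L) : L := mmap cL u P.

Definition polynomial_in_coords (f : 'I_5 -> MP) (u : 'I_5 -> L) : Prop :=
  forall j : 'I_5, exists P : MP, derL f (u j) = evalL P u.

Section Coords.
Variable alpha2 : C.
Let x := varL 0. Let y := varL 1. Let z := varL 2. Let w := varL 3. Let q := varL 4.
Let t := cL tK.
Let a := cL (cK alpha2).
Let n (k : nat) : L := k%:R.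

Definition r1 : 'I_5 -> L :=
  vec5 x y z (- (w * q + (n 2)^-1 * (n 2 * a - 1)) * q) q^-1.

Definition r2 : 'I_5 -> L :=
  vec5 (x + q / n 2) (y + q ^+ 2 / n 4) (z - (n 4)^-1 * q * (q ^+ 2 + n 8 * y))
       (- ((w + t / n 2 - n 4 * y ^+ 2 + q * (y * q - n 2 * z)) * q - (n 2)^-1 - a) * q)
       q^-1.

Definition z3 : L :=
  - x ^+ 3 * z
  - (n 64)^-1 * y * (n 4 * t + n 5 * w - n 35 * y ^+ 2)
  - (n 16)^-1 * x * (n 4 * w * q + n 2 * a + 1)
  + n 3 * y * (y ^+ 2 - w) ^+ 2 / (n 128 * x ^+ 4)
  - n 105 / n 128 * x ^+ 4 * y
  - n 7 / n 128 * x ^+ 6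
  - n 3 / n 64 * x ^+ 2 * (n 4 * t + n 15 * w - n 35 * y ^+ 2)
  + (w - n 21 * y ^+ 2) * (w - y ^+ 2) / (n 128 * x ^+ 2).

Definition r3 : 'I_5 -> L :=
  vec5 x^-1 (y / x + x) z3 (w / x ^+ 2)
       (q * x ^+ 2 + n 3 / n 4 * x * (x ^+ 2 - n 2 * y) + (w - y ^+ 2) / (n 4 * x)).
End Coords.

(* Main.v *)
Require Import Defs.
From HB Require Import structures.
From mathcomp Require Import all_boot all_algebra.
From mathcomp.real_closed Require Import complex.
From mathcomp Require Import Rstruct.
From mathcomp Require Import mpoly.
From mathcomp Require Import ring.
Import GRing.Theory.
Local Open Scope ring_scope.

(* In the charts r1 and r2 the last coordinate is s = 1/q, and the variables are Laurent
   polynomials in s with coefficients polynomial in the remaining coordinates.  Setting the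
   first three coordinates to X, Y, Z and the fourth to 0 gives a curve in s along which all
   coordinates of the chart are polynomial; so if their derivatives are polynomials in the
   coordinates, these derivatives have no pole at s = 0.  As f is quadratic, the
   derivatives are explicit Laurent polynomials in s, linear in the 105 coefficients of f.
   Letting X, Y, Z run through suitable powers of a parameter u (or 0) separates enough of
   the monomials in X, Y, Z, and the vanishing of the polar coefficients is a nearly
   triangular linear system, which leaves only the constant term of f_1 free. *)

Set Implicit Arguments.
Unset Strict Implicit.
Unset Printing Implicit Defensive.

Local Notation "x %:F" := (@FracField.tofrac _ x).

(** * Derivations of fraction fields *)

Section QuotientRules.
Variables (E : fieldType) (a a' b b' c c' d d' : E).
Hypotheses (b0 : b != 0) (d0 : d != 0).

(** The primed letters are independent of the others, so these identities serve twice: in the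
    fraction field, for formal derivatives, and in the base field, for values at a point. *)
Lemma quotient_ruleM :
  ((a' * c + a * c') * (b * d) - a * c * (b' * d + b * d')) / (b * d) ^+ 2 =
  (a' * b - a * b') / b ^+ 2 * (c / d) + a / b * ((c' * d - c * d') / d ^+ 2).
Proof. by field; rewrite b0 d0. Qed.

Lemma quotient_ruleD :
  ((a' * d + a * d' + (c' * b + c * b')) * (b * d) -
   (a * d + c * b) * (b' * d + b * d')) / (b * d) ^+ 2 =
  (a' * b - a * b') / b ^+ 2 + (c' * d - c * d') / d ^+ 2.
Proof. by field; rewrite b0 d0. Qed.

Lemma quotient_ruleV : a != 0 ->
  (b' * a - b * a') / a ^+ 2 = - ((a' * b - a * b') / b ^+ 2) / (a / b) ^+ 2.
Proof. by move=> a0; field; rewrite a0 b0. Qed.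

End QuotientRules.

Section FractionDerivation.
Variables (R : idomainType) (D : R -> R).
Hypothesis DM : forall a b, D (a * b) = D a * b + a * D b.
Hypothesis DD : forall a b, D (a + b) = D a + D b.

(** The formula of [derK] and [derL] for an arbitrary derivation [D]; both are instances of it by
    conversion. *)
Definition fderiv (u : {fraction R}) : {fraction R} :=
  let r := repr u in
  (D \n_r * \d_r - \n_r * D \d_r)%:F / (\d_r ^+ 2)%:F.

Lemma fraction_repr (u : {fraction R}) : u = (\n_(repr u))%:F / (\d_(repr u))%:F.
Proof.
have d0 := denom_ratioP (repr u).
apply: (canRL (mulfK _)); first by rewrite tofrac_eq0.
(* On representatives the equality is the cross-multiplication relation that defines fractions. *)
rewrite -[X in X * _ = _]reprK; unlock FracField.tofrac.
rewrite -[LHS]FracField.pi_mul; apply/eqmodP; rewrite /= FracField.equivfE.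
by rewrite /FracField.mulf !numden_Ratio ?oner_eq0 ?mulr1 // mulrC.
Qed.

Lemma fraction_eq (n d n' d' : R) : d != 0 -> d' != 0 ->
  n%:F / d%:F = n'%:F / d'%:F -> n * d' = n' * d.
Proof.
move=> d0 d'0 /eqP; rewrite eqr_div ?tofrac_eq0 //.
by rewrite -!tofracM tofrac_eq => /eqP.
Qed.

(** Independence of the representative [m / c]: applying [D] to [n * c = m * d] gives the relation
    that identifies the two quotients. *)
Lemma fderivE (n d : R) : d != 0 ->
  fderiv (n%:F / d%:F) = (D n * d - n * D d)%:F / (d ^+ 2)%:F.
Proof.
move=> d0; rewrite /fderiv; set u := n%:F / d%:F.
have r0 := denom_ratioP (repr u).
have e : n * \d_(repr u) = \n_(repr u) * d.
  exact: (fraction_eq d0 r0 (fraction_repr u)).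
move: (\n_(repr u)) (\d_(repr u)) r0 e => m c c0 e.
have e' : D m * d = D n * c + n * D c - m * D d.
  by apply: (canRL (addrK _)); rewrite -!DM e.
apply/eqP; rewrite eqr_div ?tofrac_eq0 ?expf_neq0 // -!tofracM tofrac_eq; apply/eqP.
(* This form isolates [D m * d] and [m * d], the two products known from [e'] and [e]. *)
transitivity (c * d * (D m * d) - (m * d) * d * D c); first by ring.
by rewrite e' -e; ring: e.
Qed.

Lemma derivation0 : D 0 = 0.
Proof. by have /eqP := DD 0 0; rewrite addr0 -subr_eq0 opprD addNKr oppr_eq0 => /eqP. Qed.

Lemma derivation1 : D 1 = 0.
Proof.
by have /eqP := DM 1 1; rewrite !mulr1 mul1r -subr_eq0 opprD addNKr oppr_eq0 => /eqP.
Qed.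

Lemma derivationN a : D (- a) = - D a.
Proof. by apply/eqP; rewrite -addr_eq0 -DD addNr derivation0. Qed.

Lemma fderiv_tofrac (n : R) : fderiv n%:F = (D n)%:F.
Proof.
rewrite -[n%:F]divr1 -tofrac1 fderivE ?oner_eq0 // derivation1.
by rewrite expr1n !mulr1 mulr0 subr0 tofrac1 divr1.
Qed.

Lemma fderivM u v : fderiv (u * v) = fderiv u * v + u * fderiv v.
Proof.
rewrite [u]fraction_repr [v]fraction_repr.
have := denom_ratioP (repr u); have := denom_ratioP (repr v).
move: (\n_(repr u)) (\d_(repr u)) (\n_(repr v)) (\d_(repr v)) => a b c d d0 b0.
rewrite mulf_div -!tofracM !fderivE ?mulf_neq0 // !DM.
rewrite !(tofracXn, tofracB, tofracM, tofracD).
by apply: quotient_ruleM; rewrite tofrac_eq0.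
Qed.

Lemma fderivD u v : fderiv (u + v) = fderiv u + fderiv v.
Proof.
rewrite [u]fraction_repr [v]fraction_repr.
have := denom_ratioP (repr u); have := denom_ratioP (repr v).
move: (\n_(repr u)) (\d_(repr u)) (\n_(repr v)) (\d_(repr v)) => a b c d d0 b0.
rewrite addf_div ?tofrac_eq0 // -!tofracM -tofracD !fderivE ?mulf_neq0 // !DM DD !DM.
rewrite !(tofracXn, tofracB, tofracM, tofracD).
by apply: quotient_ruleD; rewrite tofrac_eq0.
Qed.

End FractionDerivation.

(** * Values of rational functions and of their derivatives along a system *)

Section Jets.
Variables (E : fieldType) (dE : {additive E -> E}).
Hypothesis dEM : forall a b, dE (a * b) = dE a * b + a * dE b.
Variables (N : nat) (f : 'I_N -> {mpoly E[N]}).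
Local Notation MPE := {mpoly E[N]}.
Implicit Types (P Q : MPE) (v : 'I_N -> E) (u : {fraction MPE}).

Lemma map_mpoly_mon (c : E) (m : 'X_{1..N}) :
  map_mpoly dE (c *: 'X_[m]) = dE c *: 'X_[m].
Proof.
apply/mpolyP => k; rewrite mcoeff_map_mpoly !mcoeffZ !mcoeffX.
by rewrite !mulr_natr raddfMn.
Qed.

(** Both sides are additive in [P] and in [Q], which reduces the claim to terms [c X^m], where it is
    the product rule of [dE]. *)
Lemma map_mpoly_derivM P Q :
  map_mpoly dE (P * Q) = map_mpoly dE P * Q + P * map_mpoly dE Q.
Proof.
elim/mpolyind: P => [|c m P _ _ IHP]; first by rewrite mul0r raddf0 !mul0r add0r.
rewrite mulrDl !raddfD /= IHP map_mpoly_mon.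
suff -> : map_mpoly dE (c *: 'X_[m] * Q) =
  dE c *: 'X_[m] * Q + c *: 'X_[m] * map_mpoly dE Q by rewrite !mulrDl addrACA.
elim/mpolyind: Q {IHP} => [|c' m' Q _ _ IHQ]; first by rewrite mulr0 raddf0 !mulr0 addr0.
rewrite mulrDr !raddfD /= IHQ map_mpoly_mon !mulrDr addrACA; congr (_ + _).
rewrite -!scalerAl -!scalerAr !scalerA -mpolyXD map_mpoly_mon dEM.
by rewrite scalerDl.
Qed.

(** The total derivative along the system, as [mpD], over an abstract differential field. *)
Definition sysD P : MPE := map_mpoly dE P + \sum_(i < N) P^`M(i) * f i.

Lemma sysDM P Q : sysD (P * Q) = sysD P * Q + P * sysD Q.
Proof.
rewrite /sysD map_mpoly_derivM !mulrDl !mulrDr addrACA; congr (_ + _).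
rewrite mulr_suml mulr_sumr -big_split; apply: eq_bigr => i _ /=.
by rewrite mderivM mulrDl mulrA; congr (_ + _); exact: mulrAC.
Qed.

Lemma sysDD P Q : sysD (P + Q) = sysD P + sysD Q.
Proof.
rewrite /sysD raddfD /= addrACA -big_split; congr (_ + _); apply: eq_bigr => i _ /=.
by rewrite mderivD mulrDl.
Qed.

Lemma sysDC (c : E) : sysD c%:MP = (dE c)%:MP.
Proof.
rewrite /sysD map_mpolyC big1 ?addr0 // => i _.
by rewrite mderivC mul0r.
Qed.

Lemma sysDX (i : 'I_N) : sysD 'X_i = f i.
Proof.
have -> : 'X_i = 1 *: 'X_[U_(i)] :> MPE by rewrite scale1r.
rewrite /sysD map_mpoly_mon (derivation1 dEM) scale0r add0r scale1r.
rewrite (bigD1 i) //= big1 => [|j ji].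
  have -> : ('X_i)^`M(i) = 1 :> MPE; last by rewrite mul1r addr0.
  rewrite mderivX mnm1E eqxx scale1r -mpolyX0; congr 'X_[_].
  by apply/mnmP => k; rewrite mnmBE subnn mnm0E.
by rewrite mderivX mnm1E eq_sym (negbTE ji) scale0r mul0r.
Qed.

(* [jet v u e e'] : the rational function [u] is defined at the point [v], where it has
   the value [e] and its derivative along the system has the value [e']. *)
Definition jet (v : 'I_N -> E) u (e e' : E) : Prop :=
  exists n d : MPE, [/\ d.@[v] != 0, u = n%:F / d%:F, e = n.@[v] / d.@[v]
    & e' = ((sysD n).@[v] * d.@[v] - n.@[v] * (sysD d).@[v]) / d.@[v] ^+ 2].

Lemma meval_neq0 (v : 'I_N -> E) (d : MPE) : d.@[v] != 0 -> d != 0.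
Proof. by apply: contraNneq => ->; rewrite meval0. Qed.

Lemma jet_poly v (n : MPE) : jet v n%:F n.@[v] (sysD n).@[v].
Proof.
have D1 : sysD 1 = 0 by exact: derivation1 sysDM.
exists n, 1; rewrite D1 meval1 meval0 oner_neq0 tofrac1 !divr1.
by split=> //; rewrite expr1n mulr1 mulr0 subr0 divr1.
Qed.

Lemma jet_var v i : jet v ('X_i)%:F (v i) (f i).@[v].
Proof. by have := jet_poly v 'X_i; rewrite sysDX mevalXU. Qed.

Lemma jet_const v c : jet v (c%:MP)%:F c (dE c).
Proof. by have := jet_poly v c%:MP; rewrite sysDC !mevalC. Qed.

Lemma jet_nat v k : jet v k%:R k%:R 0.
Proof.
have Dk : dE k%:R = 0 by rewrite raddfMn /= (derivation1 dEM) mul0rn.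
by have := jet_const v k%:R; rewrite Dk mpolyC_nat tofracMn tofrac1.
Qed.

Lemma jet1 v : jet v 1 1 0.
Proof. exact: (jet_nat v 1). Qed.

Lemma jetD v u1 e1 e1' u2 e2 e2' : jet v u1 e1 e1' -> jet v u2 e2 e2' ->
  jet v (u1 + u2) (e1 + e2) (e1' + e2').
Proof.
move=> [n1 [d1 [d10 -> -> ->]]] [n2 [d2 [d20 -> -> ->]]].
have D1 := meval_neq0 d10; have D2 := meval_neq0 d20.
exists (n1 * d2 + n2 * d1), (d1 * d2); split.
- by rewrite mevalM mulf_neq0.
- by rewrite addf_div ?tofrac_eq0 // -!tofracM -tofracD.
- by rewrite addf_div // !(mevalM, mevalD).
- rewrite sysDD !sysDM.
  move: (sysD n1) (sysD n2) (sysD d1) (sysD d2) => n1' n2' d1' d2'.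
  by rewrite !(mevalM, mevalD) quotient_ruleD.
Qed.

Lemma jetM v u1 e1 e1' u2 e2 e2' : jet v u1 e1 e1' -> jet v u2 e2 e2' ->
  jet v (u1 * u2) (e1 * e2) (e1' * e2 + e1 * e2').
Proof.
move=> [n1 [d1 [d10 -> -> ->]]] [n2 [d2 [d20 -> -> ->]]].
exists (n1 * n2), (d1 * d2); split.
- by rewrite mevalM mulf_neq0.
- by rewrite mulf_div -!tofracM.
- by rewrite mulf_div !mevalM.
- rewrite !sysDM.
  move: (sysD n1) (sysD n2) (sysD d1) (sysD d2) => n1' n2' d1' d2'.
  by rewrite !(mevalM, mevalD) quotient_ruleM.
Qed.

Lemma jetN v u e e' : jet v u e e' -> jet v (- u) (- e) (- e').
Proof.
have jm1 : jet v (-1) (-1) 0.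
  have Dm1 : sysD (- 1%:MP) = 0.
    by rewrite (derivationN sysDD) sysDC (derivation1 dEM) mpolyC0 oppr0.
  by have := jet_poly v (- 1%:MP); rewrite Dm1 mevalN mevalC meval0 tofracN tofrac1.
by move=> /(jetM jm1); rewrite mul0r add0r !mulN1r.
Qed.

Lemma jetV v u e e' : e != 0 -> jet v u e e' -> jet v u^-1 e^-1 (- e' / e ^+ 2).
Proof.
move=> e0 [n [d [d0 -> eE ->]]].
move: e0; rewrite eE mulf_eq0 invr_eq0 (negbTE d0) orbF => n0.
exists d, n; split=> //; rewrite ?invf_div //.
by rewrite [RHS](quotient_ruleV _ _ d0).
Qed.

Lemma jetX2 v u e e' : jet v u e e' -> jet v (u ^+ 2) (e ^+ 2) (2%:R * e * e').
Proof.
by move=> j; have := jetM j j; rewrite -!expr2 (_ : _ + _ = 2%:R * e * e') //; ring.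
Qed.

(** The derivative is left existential here and in the next two lemmas: what is wanted is the value,
    and that the function is defined at [v]. *)
Lemma jet_ex_sum v (I : Type) (r : seq I) (u : I -> {fraction MPE}) (e : I -> E) :
  (forall i, exists e', jet v (u i) (e i) e') ->
  exists e', jet v (\sum_(i <- r) u i) (\sum_(i <- r) e i) e'.
Proof.
move=> H; elim/big_rec2: _ => [|i y1 y2 _ [y' jy]].
  by exists 0; exact: (jet_nat v 0).
by have [e' je] := H i; exists (e' + y'); exact: jetD.
Qed.

Lemma jet_ex_prod v (I : Type) (r : seq I) (u : I -> {fraction MPE}) (e : I -> E) :
  (forall i, exists e', jet v (u i) (e i) e') ->
  exists e', jet v (\prod_(i <- r) u i) (\prod_(i <- r) e i) e'.
Proof.
move=> H; elim/big_rec2: _ => [|i y1 y2 _ [y' jy]].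
  by exists 0; exact: jet1.
by have [e' je] := H i; eexists; exact: jetM je jy.
Qed.

Lemma jet_mmap v (P : MPE) (U : 'I_N -> {fraction MPE}) (e e' : 'I_N -> E) :
  (forall j, jet v (U j) (e j) (e' j)) ->
  exists p', jet v (mmap (fun c => (c%:MP)%:F) U P) P.@[e] p'.
Proof.
move=> H; apply: jet_ex_sum => m.
have [|q' jq] := @jet_ex_prod v _ (index_enum 'I_N)
    (fun i => U i ^+ m i) (fun i => e i ^+ m i).
  move=> i; elim: (m i) => [|k [k' IH]]; first by exists 0; exact: jet1.
  by rewrite !exprS; eexists; exact: jetM (H i) IH.
by eexists; exact: jetM (jet_const v _) jq.
Qed.

(** The bridge from formal to pointwise derivatives: two fractions represent the derivative of [u],
    and cross-multiplying and evaluating at [v], where neither denominator vanishes, equates their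
    values. *)
Lemma jet_fderiv v u e e' (p p' : E) :
  jet v u e e' -> jet v (fderiv sysD u) p p' -> e' = p.
Proof.
move=> [n [d [d0 -> _ ->]]]; rewrite [fderiv sysD _](fderivE sysDM) ?(meval_neq0 d0) //.
move=> [m [c [c0 q -> _]]].
have := fraction_eq _ (meval_neq0 c0) q; rewrite expf_neq0 ?(meval_neq0 d0) // => /(_ isT).
move=> /(congr1 (meval v)); rewrite !(mevalM, mevalB, rmorphXn) => q'.
by apply/eqP; rewrite eqr_div ?expf_neq0 // q'.
Qed.

End Jets.

(** * Polar coefficients *)

Section Laurent.
Variable F : fieldType.
Hypothesis natF : forall n, n.+1%:R != 0 :> F.

Lemma natF_inj : injective (fun n => n%:R : F).
Proof.
move=> m n; wlog le_mn : m n / (m <= n)%N.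
  by move=> H; case/orP: (leq_total m n) => [/H|/H E] // /esym /E.
move=> /eqP; rewrite eq_sym -subr_eq0 -natrB //.
case E : (n - m)%N => [|k]; last by rewrite (negbTE (natF k)).
by move=> _; apply/eqP; rewrite eqn_leq le_mn -subn_eq0 E.
Qed.

(** In characteristic zero the positive integers are infinitely many distinct points; 0 is left out
    because the curves exist only for [s != 0]. *)
Lemma poly0_of_roots (p : {poly F}) : (forall n, p.[n.+1%:R] = 0) -> p = 0.
Proof.
move=> p0; apply/eqP; apply: contraT => pn0.
have := @max_poly_roots _ p [seq n.+1%:R | n <- iota 0 (size p)] pn0.
rewrite size_map size_iota ltnn => -> //; first by apply/allP => _ /mapP[n _ ->]; apply/eqP.
by rewrite map_inj_uniq ?iota_uniq // => m n /natF_inj [].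
Qed.

(** The outer variable is [s], the inner one [u]. With [u] a fixed positive integer, [p] vanishes as
    a polynomial in [s]; so each of its coefficients is a polynomial in [u] with all positive
    integers as roots. *)
Lemma bipoly0 (p : {poly {poly F}}) :
  (forall u s, s != 0 -> p.[s%:P].[u] = 0) -> p = 0.
Proof.
move=> p0; apply/polyP => i; apply/polyP => j; rewrite !coef0.
pose pu n := map_poly (horner_eval (n.+1%:R : F)) p.
have pu0 n : pu n = 0.
  apply: poly0_of_roots => m; rewrite -[RHS](p0 n.+1%:R m.+1%:R) //.
  by rewrite -[m.+1%:R in LHS](hornerC _ (n.+1%:R : F)) [LHS](horner_map (horner_eval _)).
suff -> : p`_i = 0 by rewrite coef0.
apply: poly0_of_roots => n.
by have := congr1 (fun q : {poly F} => q`_i) (pu0 n); rewrite coef0 coef_map.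
Qed.

(* A list of triples [(c, m, n)] stands for the sum of the [c u^m s^n]. *)
Fixpoint lval (l : seq (F * nat * nat)) (u s : F) : F :=
  if l is (c, a, b) :: l' then c * u ^+ a * s ^+ b + lval l' u s else 0.

Fixpoint lcoef (l : seq (F * nat * nat)) (a b : nat) : F :=
  if l is (c, a', b') :: l' then
    if (a' == a) && (b' == b) then c + lcoef l' a b else lcoef l' a b
  else 0.

(* [g X Y Z s] has no pole at [s = 0], even when [X], [Y], [Z] move polynomially with a
   further parameter. *)
Definition regular (g : F -> F -> F -> F -> F) : Prop :=
  forall x y z : {poly F}, exists p : {poly {poly F}},
    forall u s, s != 0 -> g x.[u] y.[u] z.[u] s = p.[s%:P].[u].

(** With [p] from regularity, the list sums to [s^N p] for all [s != 0], hence as a polynomial, so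
    it has no coefficients below [s^N]. The choice of [x], [y], [z] as polynomials in [u] decides
    which monomials are told apart. *)
Lemma pole_coef (g : F -> F -> F -> F -> F) (x y z : {poly F}) N
    (l : seq (F * nat * nat)) : regular g ->
  (forall u s, s != 0 -> s ^+ N * g x.[u] y.[u] z.[u] s = lval l u s) ->
  forall a b, (b < N)%N -> lcoef l a b = 0.
Proof.
move=> /(_ x y z) [p pE] lE a b bN.
(* The list as a bivariate polynomial, with [s] as outer variable. *)
pose A : {poly {poly F}} := foldr (fun i q => (i.1.1 *: 'X^(i.1.2)) *: 'X^(i.2) + q) 0 l.
have AE : A = 'X^N * p.
  apply/eqP; rewrite -subr_eq0; apply/eqP; apply: bipoly0 => u s s0.
  rewrite !hornerE -pE // lE //.
  suff -> : A.[s%:P].[u] = lval l u s by rewrite subrr.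
  rewrite /A; elim: {A lE} l => [|[[c i] j] l IH] /=; first by rewrite !horner0.
  by rewrite !hornerE IH.
have : A`_b`_a = 0 by rewrite AE coefXnM bN coef0.
move=> <-; rewrite /A; elim: {A AE lE} l => [|[[c i] j] l IH] /=; first by rewrite !coef0.
rewrite coefD coefZ coefXn coefD -IH (eq_sym i) (eq_sym j).
case: (b == j); rewrite ?andbF ?andbT ?mulr0 ?mulr1 ?coef0 ?add0r // coefZ coefXn.
by case: (a == i); rewrite ?mulr1 ?mulr0 ?add0r.
Qed.

Lemma regular_meval (P : {mpoly F[5]}) :
  regular (fun x y z s => P.@[fun i : 'I_5 => nth 0 [:: x; y; z; 0; s] i]).
Proof.
move=> x y z.
pose h (i : 'I_5) : {poly {poly F}} := nth 0 [:: x%:P; y%:P; z%:P; 0; 'X] i.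
exists (mmap (polyC \o polyC) h P) => u s _.
rewrite /meval /mmap !horner_sum.
apply: eq_bigr => m _; rewrite !hornerCM; congr (_ * _).
rewrite /mmap1 !horner_prod; apply: eq_bigr => i _.
rewrite !horner_exp; congr (_ ^+ _).
by rewrite /h; case: i => [[|[|[|[|[|]]]]]] //= _; rewrite ?hornerC ?hornerX ?hornerC ?horner0.
Qed.

End Laurent.

(** * Curves in the two charts *)

Section Charts.
Variables (E : fieldType) (dE : {additive E -> E}).
Hypothesis dEM : forall a b, dE (a * b) = dE a * b + a * dE b.
Hypothesis natE : forall n, n.+1%:R != 0 :> E.
Variables t a : E.
Hypotheses (dEt : dE t = 1) (dEa : dE a = 0).
Variable f : 'I_5 -> {mpoly E[5]}.
Local Notation LE := {fraction {mpoly E[5]}}.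
Local Notation jet := (@jet E dE 5 f).

Definition point (x y z w q : E) : 'I_5 -> E := fun i => nth 0 [:: x; y; z; w; q] i.
Definition cst (c : E) : LE := (c%:MP)%:F.
Definition coord (k : nat) : LE := ('X_(inord k))%:F.
Definition chart (u0 u1 u2 u3 u4 : LE) : 'I_5 -> LE :=
  fun i => nth 0 [:: u0; u1; u2; u3; u4] i.

(** This and the two charts below copy [polynomial_in_coords], [r1] and [r2] over an abstract field,
    where [t] and [a] are letters with derivatives 1 and 0. *)
Definition polynomial_in_chart (U : 'I_5 -> LE) : Prop :=
  forall j, exists P : {mpoly E[5]}, fderiv (sysD dE f) (U j) = mmap cst U P.

Definition chart1 : 'I_5 -> LE :=
  chart (coord 0) (coord 1) (coord 2)
    (- (coord 3 * coord 4 + 2%:R^-1 * (2%:R * cst a - 1)) * coord 4) (coord 4)^-1.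

Definition chart2 : 'I_5 -> LE :=
  chart (coord 0 + coord 4 / 2%:R) (coord 1 + coord 4 ^+ 2 / 4%:R)
    (coord 2 - (4%:R)^-1 * coord 4 * (coord 4 ^+ 2 + 8%:R * coord 1))
    (- ((coord 3 + cst t / 2%:R - 4%:R * coord 1 ^+ 2 +
         coord 4 * (coord 1 * coord 4 - 2%:R * coord 2)) * coord 4 - 2%:R^-1 - cst a)
       * coord 4)
    (coord 4)^-1.

Lemma eq_regular (g h : E -> E -> E -> E -> E) : regular h ->
  (forall x y z s, s != 0 -> g x y z s = h x y z s) -> regular g.
Proof.
move=> H e x y z; have [p pE] := H x y z; exists p => u s s0.
by rewrite e // pE.
Qed.

(** On the curve the derivative of each chart coordinate is the value of a polynomial at
    [(x, y, z, 0, s)], and such values have no pole at [s = 0]. *)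
Lemma chart_regular u0 u1 u2 u3 u4 (v : E -> E -> E -> E -> 'I_5 -> E)
    (d0 d1 d2 d3 d4 : E -> E -> E -> E -> E) :
  polynomial_in_chart (chart u0 u1 u2 u3 u4) ->
  (forall x y z s, s != 0 ->
    [/\ jet (v x y z s) u0 x (d0 x y z s), jet (v x y z s) u1 y (d1 x y z s),
        jet (v x y z s) u2 z (d2 x y z s), jet (v x y z s) u3 0 (d3 x y z s)
      & jet (v x y z s) u4 s (d4 x y z s)]) ->
  [/\ regular d0, regular d1, regular d2, regular d3 & regular d4].
Proof.
move=> H J.
have reg (i : 'I_5) : regular (fun x y z s =>
    nth 0 [:: d0 x y z s; d1 x y z s; d2 x y z s; d3 x y z s; d4 x y z s] i).
  have [P PE] := H i; apply: (eq_regular (regular_meval P)) => x y z s s0.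
  have jets : forall k, jet (v x y z s) (chart u0 u1 u2 u3 u4 k)
      (nth 0 [:: x; y; z; 0; s] k)
      (nth 0 [:: d0 x y z s; d1 x y z s; d2 x y z s; d3 x y z s; d4 x y z s] k).
    by have [] := J x y z s s0; move=> ? ? ? ? ? [[|[|[|[|[|]]]]] lt_k].
  have [p' jp] := jet_mmap dEM P jets.
  by apply: (jet_fderiv dEM) (jets i) _; rewrite PE; exact: jp.
split.
- exact: (reg (@Ordinal 5 0 isT)).
- exact: (reg (@Ordinal 5 1 isT)).
- exact: (reg (@Ordinal 5 2 isT)).
- exact: (reg (@Ordinal 5 3 isT)).
- exact: (reg (@Ordinal 5 4 isT)).
Qed.

Lemma jet_eq v u e e' e1 e1' : jet v u e e' -> e = e1 -> e' = e1' -> jet v u e1 e1'.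
Proof. by move=> + <- <-. Qed.

Lemma jet_coord x y z w q k : (k < 5)%N ->
  jet (point x y z w q) (coord k) (nth 0 [:: x; y; z; w; q] k)
    (f (inord k)).@[point x y z w q].
Proof.
by move=> k5; have := jet_var dEM f (point x y z w q) (inord k); rewrite {2}/point inordK.
Qed.

Lemma jet_cst v c : jet v (cst c) c (dE c). Proof. exact: jet_const. Qed.

(** The point with coordinates [(x, y, z, 0, s)] in [chart1], found from [q = 1/s] and
    [w q + a - 1/2 = 0]. *)
Definition curve1 (x y z s : E) : 'I_5 -> E :=
  point x y z (- (a - 2%:R^-1) * s) s^-1.

(** With [b = a - 1/2], the fourth coordinate [-(w q + b) q] has derivative
    [- w' q^2 - 2 w q q' - b q'], which is [- w' q^2 + b q'] because [w q = - b] on the curve. *)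
Lemma chart1_regular : polynomial_in_chart chart1 ->
  let g k x y z s := (f (inord k)).@[curve1 x y z s] in
  [/\ regular (g 0), regular (g 1), regular (g 2)
    & regular (fun x y z s =>
        - g 3 x y z s / s ^+ 2 + (a - 2%:R^-1) * g 4 x y z s)].
Proof.
move=> H g; have [|r0 r1 r2 r3 _] := @chart_regular _ _ _ _ _ curve1 (g 0) (g 1) (g 2)
  (fun x y z s => - g 3 x y z s / s ^+ 2 + (a - 2%:R^-1) * g 4 x y z s)
  (fun x y z s => - g 4 x y z s * s ^+ 2) H; last by split.
move=> x y z s s0.
pose v := curve1 x y z s.
have [J0 J1 J2] : [/\ jet v (coord 0) x (g 0 x y z s), jet v (coord 1) y (g 1 x y z s)
  & jet v (coord 2) z (g 2 x y z s)] by split; exact: jet_coord.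
have J3 : jet v (coord 3) (- (a - 2%:R^-1) * s) (g 3 x y z s) by exact: jet_coord.
have J4 : jet v (coord 4) s^-1 (g 4 x y z s) by exact: jet_coord.
have jn k := jet_nat dEM f v k.
split=> //.
- have j2V := jetV (natE 1%N) (jn 2%N).
  have jb := jetM dEM j2V
    (jetD dEM (jetM dEM (jn 2%N) (jet_cst v a)) (jetN dEM (jet1 dEM f v))).
  apply: (jet_eq (jetM dEM (jetN dEM (jetD dEM (jetM dEM J3 J4) jb)) J4)).
    by field; rewrite ?s0 ?natE.
  by rewrite dEa; field; rewrite ?s0 ?natE.
- apply: (jet_eq (jetV _ J4)); first by rewrite invr_eq0.
    by rewrite invrK.
  by rewrite exprVn invrK.
Qed.

(** The inverse of [chart2] at [(x, y, z, 0, s)]; in [w] the terms in [q^4] cancel. *)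
Definition curve2 (x y z s : E) : 'I_5 -> E :=
  let q := s^-1 in
  point (x - q / 2%:R) (y - q ^+ 2 / 4%:R) (z + 2%:R * y * q - q ^+ 3 / 4%:R)
    (- t / 2%:R + 4%:R * y ^+ 2 + y * q ^+ 2 + 2%:R * z * q + (2%:R^-1 + a) * s) q.

(** The fourth coordinate is [-(B q - 1/2 - a) q], whose first factor vanishes on the curve; its
    derivative there is [- B' q^2 - (1/2 + a) q']. The summand [1/2] in [B'] is the derivative of
    [t / 2], and the partial derivatives of [B] are rewritten in the chart coordinates. *)
Lemma chart2_regular : polynomial_in_chart chart2 ->
  let g k x y z s := (f (inord k)).@[curve2 x y z s] in
  [/\ regular (fun x y z s => g 0 x y z s + g 4 x y z s / 2%:R),
      regular (fun x y z s => g 1 x y z s + s^-1 / 2%:R * g 4 x y z s),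
      regular (fun x y z s => g 2 x y z s - 2%:R / s * g 1 x y z s
        - (s ^- 2 / 4%:R + 2%:R * y) * g 4 x y z s),
      regular (fun x y z s =>
        - (g 3 x y z s + 2%:R^-1 - (8%:R * y - 3%:R / s ^+ 2) * g 1 x y z s
           - 2%:R / s * g 2 x y z s
           - (2%:R * z + 2%:R * y / s) * g 4 x y z s) / s ^+ 2
        - (2%:R^-1 + a) * g 4 x y z s)
    & regular (fun x y z s => - g 4 x y z s * s ^+ 2)].
Proof.
move=> H g; apply: (@chart_regular _ _ _ _ _ curve2 _ _ _ _ _ H).
move=> x y z s s0.
pose v := curve2 x y z s; pose q := s^-1.
have J0 : jet v (coord 0) (x - q / 2%:R) (g 0 x y z s) by exact: jet_coord.
have J1 : jet v (coord 1) (y - q ^+ 2 / 4%:R) (g 1 x y z s) by exact: jet_coord.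
have J2 : jet v (coord 2) (z + 2%:R * y * q - q ^+ 3 / 4%:R) (g 2 x y z s).
  exact: jet_coord.
have J3 : jet v (coord 3) (- t / 2%:R + 4%:R * y ^+ 2 + y * q ^+ 2 + 2%:R * z * q
  + (2%:R^-1 + a) * s) (g 3 x y z s) by exact: jet_coord.
have J4 : jet v (coord 4) q (g 4 x y z s) by exact: jet_coord.
rewrite {}/q in J0 J1 J2 J3 J4.
have jn k := jet_nat dEM f v k.
have jV k := jetV (natE k) (jn k.+1).
split.
- apply: (jet_eq (jetD dEM J0 (jetM dEM J4 (jV 1%N)))); first by field; rewrite ?s0 ?natE.
  by field; rewrite ?s0 ?natE.
- apply: (jet_eq (jetD dEM J1 (jetM dEM (jetX2 dEM J4) (jV 3%N)))).
    by field; rewrite ?s0 ?natE.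
  by field; rewrite ?s0 ?natE.
- apply: (jet_eq (jetD dEM J2 (jetN dEM (jetM dEM (jetM dEM (jV 3%N) J4)
    (jetD dEM (jetX2 dEM J4) (jetM dEM (jn 8%N) J1)))))).
    by field; rewrite ?s0 ?natE.
  by field; rewrite ?s0 ?natE.
- have jA := jetD dEM (jetD dEM (jetD dEM J3 (jetM dEM (jet_cst v t) (jV 1%N)))
      (jetN dEM (jetM dEM (jn 4%N) (jetX2 dEM J1))))
    (jetM dEM J4 (jetD dEM (jetM dEM J1 J4) (jetN dEM (jetM dEM (jn 2%N) J2)))).
  have jB := jetD dEM (jetD dEM (jetM dEM jA J4) (jetN dEM (jV 1%N)))
    (jetN dEM (jet_cst v a)).
  apply: (jet_eq (jetM dEM (jetN dEM jB) J4)).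
    by field; rewrite ?s0 ?natE.
  by rewrite dEt dEa; field; rewrite ?s0 ?natE.
- apply: (jet_eq (jetV _ J4)); first by rewrite invr_eq0.
    by rewrite invrK.
  by rewrite exprVn invrK.
Qed.

End Charts.

(** * Quadratic polynomials *)

(* [c i j] is the coefficient of [h_i h_j], where [h_0, ..., h_5 = 1, x, y, z, w, q] and
   [i <= j]. *)
Definition quad (R : pzRingType) (c : nat -> nat -> R) (x y z w q : R) : R :=
  c 0 0 + c 0 1 * x + c 0 2 * y + c 0 3 * z + c 0 4 * w + c 0 5 * q
  + c 1 1 * x ^+ 2 + c 1 2 * (x * y) + c 1 3 * (x * z) + c 1 4 * (x * w) + c 1 5 * (x * q)
  + c 2 2 * y ^+ 2 + c 2 3 * (y * z) + c 2 4 * (y * w) + c 2 5 * (y * q)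
  + c 3 3 * z ^+ 2 + c 3 4 * (z * w) + c 3 5 * (z * q)
  + c 4 4 * w ^+ 2 + c 4 5 * (w * q) + c 5 5 * q ^+ 2.

Lemma quadD (R : comPzRingType) (c d : nat -> nat -> R) (x y z w q : R) :
  quad (fun i j => c i j + d i j) x y z w q = quad c x y z w q + quad d x y z w q.
Proof. by rewrite /quad; ring. Qed.

Section Quadratic.
Variable E : fieldType.
Implicit Types P : {mpoly E[5]}.

Definition mquad (c : nat -> nat -> E) : {mpoly E[5]} :=
  quad (fun i j => (c i j)%:MP) 'X_(inord 0) 'X_(inord 1) 'X_(inord 2) 'X_(inord 3)
    'X_(inord 4).

Lemma meval_mquad c x y z w q : (mquad c).@[point x y z w q] = quad c x y z w q.
Proof.
rewrite /mquad /quad !(mevalD, mevalM, rmorphXn) /= !mevalC !mevalXU.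
by rewrite /point !inordK.
Qed.

Lemma mquad_mon2 (c : E) (i j : 'I_5) : exists d, c *: ('X_i * 'X_j) = mquad d.
Proof.
wlog le_ij : i j / (i <= j)%N.
  by move=> H; case/orP: (leq_total i j) => /H //; rewrite mulrC.
(* Indices are shifted by one because [h_0] is the constant 1. *)
exists (fun k l => c *+ ((k == i.+1) && (l == j.+1))).
rewrite -{1}[ i ]inord_val -{1}[ j ]inord_val -mul_mpolyC.
case: i j le_ij => [[|[|[|[|[|?]]]]] ?] [[|[|[|[|[|?]]]]] ?] //= _;
  by rewrite /mquad /quad /= !mulr0n mulr1n mpolyC0 !mul0r !(add0r, addr0) ?expr2.
Qed.

Lemma mquad_mon1 (c : E) (i : 'I_5) : exists d, c *: 'X_i = mquad d.
Proof.
exists (fun k l => c *+ ((k == 0%N) && (l == i.+1))).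
rewrite -{1}[ i ]inord_val -mul_mpolyC.
case: i => [[|[|[|[|[|?]]]]] ?] //=;
  by rewrite /mquad /quad /= !mulr0n mulr1n mpolyC0 !mul0r !(add0r, addr0).
Qed.

Lemma mquad_mon0 (c : E) : exists d, c%:MP = mquad d.
Proof.
exists (fun k l => c *+ ((k == 0%N) && (l == 0%N))).
by rewrite /mquad /quad /= !mulr0n mulr1n mpolyC0 !mul0r !addr0.
Qed.

Lemma mdeg_gt0_split (n : nat) (m : 'X_{1..n}) : (0 < mdeg m)%N ->
  exists i m', m = (U_(i) + m')%MM /\ mdeg m = (mdeg m').+1.
Proof.
move=> m0; have [i mi] : exists i, (0 < m i)%N.
  apply/existsP; apply: contraTT m0; rewrite negb_exists -leqNgt leqn0 mdegE => /forallP H.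
  by rewrite big1 // => i _; apply/eqP; rewrite -leqn0 leqNgt H.
have mE : m = (U_(i) + (m - U_(i)))%MM by rewrite addmC submK // lep1mP -lt0n.
by exists i, (m - U_(i))%MM; split=> //; rewrite {1}mE mdegD mdeg1.
Qed.

(** [msize] is the degree plus one, so splitting off at most two variables exhausts every
    monomial. *)
Lemma mquad_exists P : (msize P <= 3)%N -> exists c, P = mquad c.
Proof.
move=> sP; rewrite [P]mpolyE big_seq; apply: (big_ind (fun Q => exists c, Q = mquad c)).
- by have [d dE] := mquad_mon0 0; exists d; rewrite -dE mpolyC0.
- move=> _ _ [c ->] [d ->]; exists (fun i j => c i j + d i j).
  by rewrite /mquad -quadD /quad !mpolyCD.
move=> m /msize_mdeg_lt /leq_trans /(_ sP); move: (P@_m) => c.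
case: (posnP (mdeg m)) => [/eqP|/mdeg_gt0_split [i [m' [-> ->]]]].
  by rewrite mdeg_eq0 => /eqP -> _; rewrite mpolyX0 alg_mpolyC; exact: mquad_mon0.
case: (posnP (mdeg m')) => [/eqP|/mdeg_gt0_split [j [m'' [-> ->]]]].
  by rewrite mdeg_eq0 => /eqP -> _; rewrite addm0; exact: mquad_mon1.
rewrite !ltnS leqn0 mdeg_eq0 => /eqP ->; rewrite addm0 mpolyXD.
exact: mquad_mon2.
Qed.

End Quadratic.

(** * The linear system for the coefficients *)

Section Coefficients.
Variable E : fieldType.
Hypothesis natE : forall n, n.+1%:R != 0 :> E.
Variables t a : E.

Definition quad_curve1 (c : nat -> nat -> E) (x y z s : E) : E :=
  quad c x y z (- (a - 2%:R^-1) * s) s^-1.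

Definition quad_curve2 (c : nat -> nat -> E) (x y z s : E) : E :=
  let q := s^-1 in
  quad c (x - q / 2%:R) (y - q ^+ 2 / 4%:R) (z + 2%:R * y * q - q ^+ 3 / 4%:R)
    (- t / 2%:R + 4%:R * y ^+ 2 + y * q ^+ 2 + 2%:R * z * q + (2%:R^-1 + a) * s) q.

(** Solves one linear equation: [e] is a vanishing polar coefficient, [l] the unknown, and [k] the
    inverse of its coefficient in [e]. *)
Lemma lcomb (k e l r : E) : e = 0 -> l - r = k * e -> l = r.
Proof. by move=> ->; rewrite mulr0 => /eqP; rewrite subr_eq0 => /eqP. Qed.
Arguments lcomb k {e l r}.

Local Notation "[ 'term' c , m , n ]" := (c%R, m%N, n%N).
Local Ltac field_nat := field; rewrite ?natE.

(* In the tables below, [[term c, m, n]] means that [c] is the coefficient of [u^m s^n] in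
   [s^N] times the function considered, [N] being its pole order: the entries with
   [n < N] vanish. *)
Lemma chart1_pole (c : nat -> nat -> E) : regular (quad_curve1 c) ->
  [/\ c 0%N 5%N = 0, c 1%N 5%N = 0, c 2%N 5%N = 0, c 3%N 5%N = 0 & c 5%N 5%N = 0].
Proof.
move=> r1x.
have poles m n (lt_n : (n < 2)%N) : lcoef [::
    [term c 5%N 5%N, 0, 0]; [term c 0%N 5%N, 0, 1]; [term c 1%N 5%N, 1, 1];
    [term c 2%N 5%N, 2, 1];
    [term c 3%N 5%N, 3, 1]; [term c 0%N 0%N + (1 / 2%:R - a) * c 4%N 5%N, 0, 2];
    [term c 0%N 1%N, 1, 2];
    [term c 0%N 2%N + c 1%N 1%N, 2, 2]; [term c 0%N 3%N + c 1%N 2%N, 3, 2];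
    [term c 1%N 3%N + c 2%N 2%N, 4, 2]; [term c 2%N 3%N, 5, 2]; [term c 3%N 3%N, 6, 2];
    [term (1 / 2%:R - a) * c 0%N 4%N, 0, 3]; [term (1 / 2%:R - a) * c 1%N 4%N, 1, 3];
    [term (1 / 2%:R - a) * c 2%N 4%N, 2, 3]; [term (1 / 2%:R - a) * c 3%N 4%N, 3, 3];
    [term (1 / 4%:R - a + a ^+ 2) * c 4%N 4%N, 0, 4]] m n = 0.
  (* The pole has order 2, from [q^2]; the powers [u], [u^2], [u^3] keep [q], [x q], [y q], [z q]
     apart. *)
  apply: (pole_coef natE (x := 'X) (y := 'X^2) (z := 'X^3) r1x) lt_n => u s s0.
  rewrite !(hornerXn, hornerX) /quad_curve1 /quad /=.
  by field; rewrite ?s0 ?natE.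
split; [apply: (lcomb 1 (poles 0 1 isT)%N)|apply: (lcomb 1 (poles 1 1 isT)%N)|
  apply: (lcomb 1 (poles 2 1 isT)%N)|apply: (lcomb 1 (poles 3 1 isT)%N)|
  apply: (lcomb 1 (poles 0 0 isT)%N)]; by rewrite /=; field_nat.
Qed.

Variables cx cy cz cw cq : nat -> nat -> E.
Arguments cx (_ _)%_nat_scope.
Arguments cy (_ _)%_nat_scope.
Arguments cz (_ _)%_nat_scope.
Arguments cw (_ _)%_nat_scope.
Arguments cq (_ _)%_nat_scope.

(** Elimination, one unknown at a time, first with chart 1 and then with the components [q], [y],
    [z], [x], [w] of chart 2. Every pivot is a nonzero rational number, so no case distinction on
    [a] or [t] arises. A hypothesis such as [q12] records the current value of [cq 1 2]. *)
Lemma regular_coefficients :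
  regular (quad_curve1 cx) -> regular (quad_curve1 cy) -> regular (quad_curve1 cz) ->
  regular (fun x y z s =>
    - quad_curve1 cw x y z s / s ^+ 2 + (a - 2%:R^-1) * quad_curve1 cq x y z s) ->
  regular (fun x y z s => quad_curve2 cx x y z s + quad_curve2 cq x y z s / 2%:R) ->
  regular (fun x y z s => quad_curve2 cy x y z s + s^-1 / 2%:R * quad_curve2 cq x y z s) ->
  regular (fun x y z s => quad_curve2 cz x y z s - 2%:R / s * quad_curve2 cy x y z s
    - (s ^- 2 / 4%:R + 2%:R * y) * quad_curve2 cq x y z s) ->
  regular (fun x y z s =>
    - (quad_curve2 cw x y z s + 2%:R^-1 - (8%:R * y - 3%:R / s ^+ 2) * quad_curve2 cy x y z s
       - 2%:R / s * quad_curve2 cz x y z s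
       - (2%:R * z + 2%:R * y / s) * quad_curve2 cq x y z s) / s ^+ 2
    - (2%:R^-1 + a) * quad_curve2 cq x y z s) ->
  regular (fun x y z s => - quad_curve2 cq x y z s * s ^+ 2) ->
  [/\ mquad cx = 'X_(inord 1) + (cx 0 0)%:MP,
      mquad cy = 'X_(inord 2),
      mquad cz = - 6%:R * 'X_(inord 1) ^+ 2 + 'X_(inord 3) + (t / 4%:R)%:MP,
      mquad cw = 'X_(inord 3) * 'X_(inord 4) + ((2%:R * a - 1) / 4%:R)%:MP
    & mquad cq = - (2%:R^-1 : E)%:MP * 'X_(inord 4) ^+ 2 - 4%:R * 'X_(inord 1)].
Proof.
move=> r1x r1y r1z r1w r2x r2y r2z r2w r2q.
(* In the first three components [q] can now occur only through [w q], which is constant on the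
   first curve. *)
have [x05 x15 x25 x35 x55] := chart1_pole r1x.
have [y05 y15 y25 y35 y55] := chart1_pole r1y.
have [z05 z15 z25 z35 z55] := chart1_pole r1z.
(* Fourth component in chart 1: dividing by [s^2] raises the pole order to 4. For [u], [u^3], [u^4]
   the only coincidence among monomials of degree at most 2 in [x], [y], [z] is [z] with [x y]. *)
have poles m n (lt_n : (n < 4)%N) : lcoef [::
    [term - cw 5 5, 0, 0]; [term - cw 0 5, 0, 1]; [term - cw 1 5, 1, 1];
    [term - cw 2 5, 3, 1]; [term - cw 3 5, 4, 1];
    [term - cw 0 0 + (- 1 / 2%:R + a) * cw 4 5 + (- 1 / 2%:R + a) * cq 5 5, 0, 2];
    [term - cw 0 1, 1, 2]; [term - cw 1 1, 2, 2]; [term - cw 0 2, 3, 2];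
    [term - cw 0 3 - cw 1 2, 4, 2]; [term - cw 1 3, 5, 2]; [term - cw 2 2, 6, 2];
    [term - cw 2 3, 7, 2]; [term - cw 3 3, 8, 2];
    [term (- 1 / 2%:R + a) * cw 0 4 + (- 1 / 2%:R + a) * cq 0 5, 0, 3];
    [term (- 1 / 2%:R + a) * cw 1 4 + (- 1 / 2%:R + a) * cq 1 5, 1, 3];
    [term (- 1 / 2%:R + a) * cw 2 4 + (- 1 / 2%:R + a) * cq 2 5, 3, 3];
    [term (- 1 / 2%:R + a) * cw 3 4 + (- 1 / 2%:R + a) * cq 3 5, 4, 3];
    [term (- 1 / 4%:R + a - a ^+ 2) * cw 4 4 + (- 1 / 2%:R + a) * cq 0 0 + (- 1 / 4%:R + a
      - a ^+ 2) * cq 4 5, 0, 4];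
    [term (- 1 / 2%:R + a) * cq 0 1, 1, 4]; [term (- 1 / 2%:R + a) * cq 1 1, 2, 4];
    [term (- 1 / 2%:R + a) * cq 0 2, 3, 4];
    [term (- 1 / 2%:R + a) * cq 0 3 + (- 1 / 2%:R + a) * cq 1 2, 4, 4];
    [term (- 1 / 2%:R + a) * cq 1 3, 5, 4]; [term (- 1 / 2%:R + a) * cq 2 2, 6, 4];
    [term (- 1 / 2%:R + a) * cq 2 3, 7, 4]; [term (- 1 / 2%:R + a) * cq 3 3, 8, 4];
    [term (- 1 / 4%:R + a - a ^+ 2) * cq 0 4, 0, 5];
    [term (- 1 / 4%:R + a - a ^+ 2) * cq 1 4, 1, 5];
    [term (- 1 / 4%:R + a - a ^+ 2) * cq 2 4, 3, 5];
    [term (- 1 / 4%:R + a - a ^+ 2) * cq 3 4, 4, 5];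
    [term (- 1 / 8%:R + 3%:R / 4%:R * a - 3%:R / 2%:R * a ^+ 2 + a ^+ 3) * cq 4 4, 0, 6]] m n = 0.
  apply: (pole_coef natE (x := 'X) (y := 'X^3) (z := 'X^4) r1w) lt_n => u s s0.
  rewrite !(hornerXn, hornerX) /quad_curve1 /quad /=.
  by field; rewrite ?s0 ?natE.
have w55 : cw 5 5 = 0 by apply: (lcomb (- 1) (poles 0 0 isT)%N); rewrite /=; field_nat.
have w05 : cw 0 5 = 0 by apply: (lcomb (- 1) (poles 0 1 isT)%N); rewrite /=; field_nat.
have w15 : cw 1 5 = 0 by apply: (lcomb (- 1) (poles 1 1 isT)%N); rewrite /=; field_nat.
have w01 : cw 0 1 = 0 by apply: (lcomb (- 1) (poles 1 2 isT)%N); rewrite /=; field_nat.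
have w11 : cw 1 1 = 0 by apply: (lcomb (- 1) (poles 2 2 isT)%N); rewrite /=; field_nat.
have w25 : cw 2 5 = 0 by apply: (lcomb (- 1) (poles 3 1 isT)%N); rewrite /=; field_nat.
have w02 : cw 0 2 = 0 by apply: (lcomb (- 1) (poles 3 2 isT)%N); rewrite /=; field_nat.
have w35 : cw 3 5 = 0 by apply: (lcomb (- 1) (poles 4 1 isT)%N); rewrite /=; field_nat.
have w13 : cw 1 3 = 0 by apply: (lcomb (- 1) (poles 5 2 isT)%N); rewrite /=; field_nat.
have w22 : cw 2 2 = 0 by apply: (lcomb (- 1) (poles 6 2 isT)%N); rewrite /=; field_nat.
have w23 : cw 2 3 = 0 by apply: (lcomb (- 1) (poles 7 2 isT)%N); rewrite /=; field_nat.
have w33 : cw 3 3 = 0 by apply: (lcomb (- 1) (poles 8 2 isT)%N); rewrite /=; field_nat.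
have w03 : cw 0 3 = - cw 1 2 by apply: (lcomb (- 1) (poles 4 2 isT)%N); rewrite /=;
  field_nat.
have w00 : cw 0 0 = (- 1 / 2%:R + a) * cw 4 5 + (- 1 / 2%:R + a) * cq 5 5 by apply: (lcomb
  (- 1) (poles 0 2 isT)%N); rewrite /=; field_nat.
(* Kept unsolved, since its factor [a - 1/2] may vanish. *)
have w04q05 := poles 0%N 3%N isT; rewrite /= in w04q05.
clear poles.
(* Last component in chart 2: on the curve [z^2] grows like [s^-6], and the factor [s^2] leaves
   order 4. *)
have poles m n (lt_n : (n < 4)%N) : lcoef [::
    [term - 1 / 16%:R * cq 3 3, 0, 0]; [term - 1 / 16%:R * cq 2 3, 0, 1];
    [term 1 / 4%:R * cq 3 4, 1, 1];
    [term - 1 / 8%:R * cq 1 3 - 1 / 16%:R * cq 2 2 + 1 / 4%:R * cq 3 5, 0, 2];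
    [term 1 / 4%:R * cq 2 4 + cq 3 3, 1, 2]; [term - cq 4 4, 2, 2];
    [term 1 / 4%:R * cq 0 3 - 1 / 8%:R * cq 1 2 + 1 / 4%:R * cq 2 5 - 1 / 8%:R * t * cq 3 4,
      0, 3];
    [term 1 / 2%:R * cq 1 4 + 3%:R / 4%:R * cq 2 3 - cq 4 5, 1, 3];
    [term 1 / 4%:R * cq 1 3 - cq 3 4, 2, 3];
    [term 1 / 4%:R * cq 0 2 - 1 / 4%:R * cq 1 1 + 1 / 2%:R * cq 1 5 - 1 / 8%:R * t * cq 2 4
      + (1 / 8%:R + 1 / 4%:R * a) * cq 3 4 - cq 5 5, 0, 4];
    [term - cq 0 4 + cq 1 3 + 1 / 2%:R * cq 2 2 - 2%:R * cq 3 5 + t * cq 4 4, 1, 4];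
    [term 1 / 4%:R * cq 1 2 - 4%:R * cq 3 3, 2, 4]; [term - cq 1 4 - 8%:R * cq 4 4, 3, 4];
    [term 1 / 2%:R * cq 0 1 - cq 0 5 - 1 / 4%:R * t * cq 1 4 + (1 / 8%:R + 1 / 4%:R * a) *
      cq 2 4 + 1 / 2%:R * t * cq 4 5, 0, 5];
    [term - 2%:R * cq 0 3 + 1 / 2%:R * cq 1 2 - cq 2 5 + t * cq 3 4 + (- 1 - 2%:R * a) *
      cq 4 4, 1, 5];
    [term cq 1 1 + 2%:R * cq 1 4 - cq 1 5 - 2%:R * cq 2 3 - 4%:R * cq 4 5, 2, 5];
    [term - 2%:R * cq 1 3 - 8%:R * cq 3 4, 3, 5];
    [term - cq 0 0 + 1 / 2%:R * t * cq 0 4 + (1 / 4%:R + 1 / 2%:R * a) * cq 1 4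
      - 1 / 4%:R * t ^+ 2 * cq 4 4 + (- 1 / 2%:R - a) * cq 4 5, 0, 6];
    [term - cq 0 2 + 1 / 2%:R * t * cq 2 4 + (- 1 - 2%:R * a) * cq 3 4, 1, 6];
    [term - cq 0 1 - 4%:R * cq 0 4 + 1 / 2%:R * t * cq 1 4 - cq 2 2 + 4%:R * t * cq 4 4, 2,
      6];
    [term - cq 1 2 - 4%:R * cq 2 4, 3, 6];
    [term - cq 1 1 - 4%:R * cq 1 4 - 16%:R * cq 4 4, 4, 6];
    [term (- 1 / 2%:R - a) * cq 0 4 + (1 / 2%:R * t + t * a) * cq 4 4, 0, 7];
    [term (- 1 / 2%:R - a) * cq 2 4, 1, 7];
    [term (- 1 / 2%:R - a) * cq 1 4 + (- 4%:R - 8%:R * a) * cq 4 4, 2, 7];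
    [term (- 1 / 4%:R - a - a ^+ 2) * cq 4 4, 0, 8]] m n = 0.
  apply: (pole_coef natE (x := 'X^2) (y := 'X) (z := 0) r2q) lt_n => u s s0.
  rewrite !(hornerXn, hornerX, horner0) /quad_curve2 /quad /=.
  by field; rewrite ?s0 ?natE.
have q44 : cq 4 4 = 0 by apply: (lcomb (- 1) (poles 2 2 isT)%N); rewrite /=; field_nat.
have q34 : cq 3 4 = 0 by apply: (lcomb 4%:R (poles 1 1 isT)%N); rewrite /=; field_nat.
have q33 : cq 3 3 = 0 by apply: (lcomb (- 16%:R) (poles 0 0 isT)%N); rewrite /=; field_nat.
have q23 : cq 2 3 = 0 by apply: (lcomb (- 16%:R) (poles 0 1 isT)%N); rewrite /=; field_nat.
have q24 : cq 2 4 = 0 by apply: (lcomb 4%:R (poles 1 2 isT)%N); rewrite /= q33; field_nat.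
have q13 : cq 1 3 = 0 by apply: (lcomb 4%:R (poles 2 3 isT)%N); rewrite /= q34; field_nat.
have q45 : cq 4 5 = 1 / 2%:R * cq 1 4 by apply: (lcomb (- 1) (poles 1 3 isT)%N); rewrite /=
  q23; field_nat.
have q35 : cq 3 5 = 1 / 4%:R * cq 2 2 by apply: (lcomb 4%:R (poles 0 2 isT)%N); rewrite /=
  q13; field_nat.
have q03 : cq 0 3 = 1 / 2%:R * cq 1 2 - cq 2 5 by apply: (lcomb 4%:R (poles 0 3
  isT)%N); rewrite /= q34; field_nat.
clear poles.
(* Second component in chart 2. The factor [1/s] before [cq] would give order 7, but [cq 3 3 = 0] is
   already known. Unknowns of [cy] and [cq] are eliminated together. *)
have poles m n (lt_n : (n < 6)%N) : lcoef [::
    [term 1 / 16%:R * cy 3 3, 0, 0]; [term 1 / 16%:R * cy 2 3, 0, 1];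
    [term - 1 / 4%:R * cy 3 4, 2, 1]; [term 1 / 8%:R * cy 1 3 + 1 / 16%:R * cy 2 2, 0, 2];
    [term - 1 / 2%:R * cy 3 4, 1, 2]; [term - 1 / 4%:R * cy 2 4 - cy 3 3, 2, 2];
    [term cy 4 4, 4, 2];
    [term - 1 / 4%:R * cy 0 3 + 1 / 8%:R * cy 1 2 + 1 / 8%:R * t * cy 3 4
      - 1 / 8%:R * cq 0 2 + 1 / 8%:R * cq 1 1 - 1 / 4%:R * cq 1 5 + 1 / 2%:R * cq 5 5, 0,
      3];
    [term - 1 / 2%:R * cy 2 4 - 1 / 2%:R * cy 3 3, 1, 3];
    [term - 1 / 2%:R * cy 1 4 - 3%:R / 4%:R * cy 2 3 + cy 4 5 + 1 / 2%:R * cq 0 4, 2, 3];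
    [term - 1 / 4%:R * cy 1 3 + 4%:R * cy 4 4 - 1 / 8%:R * cq 1 2, 3, 3];
    [term cy 3 4, 4, 3]; [term 1 / 2%:R * cq 1 4, 5, 3];
    [term - 1 / 4%:R * cy 0 2 + 1 / 4%:R * cy 1 1 + 1 / 8%:R * t * cy 2 4 + (- 1 / 8%:R
      - 1 / 4%:R * a) * cy 3 4 - 1 / 4%:R * cq 0 1 + 1 / 2%:R * cq 0 5, 0, 4];
    [term - cy 1 4 - 1 / 4%:R * cy 2 3 + 2%:R * cy 4 5 + cq 0 4 + 1 / 8%:R * cq 2 2, 1, 4];
    [term cy 0 4 - cy 1 3 - 1 / 2%:R * cy 2 2 + (4%:R - t) * cy 4 4 + 1 / 4%:R * cq 1 2
      - 1 / 2%:R * cq 2 5, 2, 4];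
    [term - 1 / 4%:R * cy 1 2 + 5%:R * cy 3 4 - 1 / 2%:R * cq 1 1 + 1 / 2%:R * cq 1 5, 3,
      4];
    [term 4%:R * cy 3 3 + cq 1 4, 4, 4]; [term cy 1 4, 5, 4]; [term 8%:R * cy 4 4, 6, 4];
    [term - 1 / 2%:R * cy 0 1 + 1 / 4%:R * t * cy 1 4 + (- 1 / 8%:R - 1 / 4%:R * a) * cy 2 4
      - 1 / 2%:R * t * cy 4 5 + 1 / 2%:R * cq 0 0 - 1 / 4%:R * t * cq 0 4, 0, 5];
    [term 2%:R * cy 0 4 - 1 / 2%:R * cy 1 3 - 2%:R * t * cy 4 4 + 1 / 4%:R * cq 1 2
      - 1 / 2%:R * cq 2 5, 1, 5];
    [term 2%:R * cy 0 3 - 1 / 2%:R * cy 1 2 + (2%:R - t) * cy 3 4 + (1 + 2%:R * a) * cy 4 4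
      + 1 / 2%:R * cq 0 2, 2, 5];
    [term - cy 1 1 + 2%:R * cy 2 4 + 4%:R * cy 3 3 + 1 / 2%:R * cq 0 1 - 1 / 4%:R * t *
      cq 1 4, 3, 5];
    [term 2%:R * cy 2 3 + 4%:R * cy 4 5 + 2%:R * cq 0 4 + 1 / 2%:R * cq 2 2, 4, 5];
    [term 2%:R * cy 1 3 + 16%:R * cy 4 4 + 1 / 2%:R * cq 1 2, 5, 5];
    [term 8%:R * cy 3 4 + 1 / 2%:R * cq 1 1, 6, 5]; [term 2%:R * cq 1 4, 7, 5];
    [term cy 0 0 - 1 / 2%:R * t * cy 0 4 + (- 1 / 4%:R - 1 / 2%:R * a) * cy 1 4
      + 1 / 4%:R * t ^+ 2 * cy 4 4 + (1 / 2%:R + a) * cy 4 5 + (1 / 4%:R + 1 / 2%:R * a) *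
      cq 0 4, 0, 6];
    [term cy 0 3 - 1 / 2%:R * t * cy 3 4 + (2%:R + 4%:R * a) * cy 4 4, 1, 6];
    [term cy 0 2 - 1 / 2%:R * t * cy 2 4 + cy 3 3 + (1 + 2%:R * a) * cy 3 4, 2, 6];
    [term cy 0 1 - 1 / 2%:R * t * cy 1 4 + cy 2 3 + (1 / 4%:R + 1 / 2%:R * a) * cq 1 4, 3,
      6];
    [term 4%:R * cy 0 4 + cy 1 3 + cy 2 2 - 4%:R * t * cy 4 4, 4, 6];
    [term cy 1 2 + 4%:R * cy 3 4, 5, 6]; [term cy 1 1 + 4%:R * cy 2 4, 6, 6];
    [term 4%:R * cy 1 4, 7, 6]; [term 16%:R * cy 4 4, 8, 6];
    [term (1 / 2%:R + a) * cy 0 4 + (- 1 / 2%:R * t - t * a) * cy 4 4, 0, 7];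
    [term (1 / 2%:R + a) * cy 3 4, 1, 7]; [term (1 / 2%:R + a) * cy 2 4, 2, 7];
    [term (1 / 2%:R + a) * cy 1 4, 3, 7]; [term (4%:R + 8%:R * a) * cy 4 4, 4, 7];
    [term (1 / 4%:R + a + a ^+ 2) * cy 4 4, 0, 8]] m n = 0.
  apply: (pole_coef natE (x := 'X^3) (y := 'X^2) (z := 'X) r2y) lt_n => u s s0.
  rewrite !(hornerXn, hornerX) /quad_curve2 /quad
    ?(y05, y15, y25, y35, y55, q44, q34, q33, q23, q24,
    q13, q45, q35, q03) /=.
  by field; rewrite ?s0 ?natE.
have y44 : cy 4 4 = 0 by apply: (lcomb 1 (poles 4 2 isT)%N); rewrite /=; field_nat.
have y34 : cy 3 4 = 0 by apply: (lcomb 1 (poles 4 3 isT)%N); rewrite /=; field_nat.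
have y14 : cy 1 4 = 0 by apply: (lcomb 1 (poles 5 4 isT)%N); rewrite /=; field_nat.
have q14 : cq 1 4 = 0 by apply: (lcomb 2%:R (poles 5 3 isT)%N); rewrite /=; field_nat.
have y33 : cy 3 3 = 0 by apply: (lcomb 16%:R (poles 0 0 isT)%N); rewrite /=; field_nat.
have y23 : cy 2 3 = 0 by apply: (lcomb 16%:R (poles 0 1 isT)%N); rewrite /=; field_nat.
have y24 : cy 2 4 = 0 by apply: (lcomb (- 2%:R) (poles 1 3 isT)%N); rewrite /= y33;
  field_nat.
have q11 : cq 1 1 = 0 by apply: (lcomb 2%:R (poles 6 5 isT)%N); rewrite /= y34; field_nat.
have y13 : cy 1 3 = - 1 / 2%:R * cy 2 2 by apply: (lcomb 8%:R (poles 0 2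
  isT)%N); rewrite /=; field_nat.
have y45 : cy 4 5 = - 1 / 2%:R * cq 0 4 by apply: (lcomb 1 (poles 2 3 isT)%N); rewrite /=
  ?(y14, y23); field_nat.
have q22 : cq 2 2 = 0 by apply: (lcomb 2%:R (poles 4 5 isT)%N); rewrite /= ?(y23, y45);
  field_nat.
have y22 : cy 2 2 = 1 / 2%:R * cq 1 2 by apply: (lcomb (- 1) (poles 5 5 isT)%N); rewrite /=
  ?(y13, y44); field_nat.
have q12 : cq 1 2 = 0 by apply: (lcomb (- 16%:R) (poles 3 3 isT)%N); rewrite /= ?(y13, y44,
  y22); field_nat.
have q15 : cq 1 5 = 1 / 2%:R * cy 1 2 by apply: (lcomb 2%:R (poles 3 4 isT)%N); rewrite /=
  ?(y34, q11); field_nat.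
have y04 : cy 0 4 = 1 / 2%:R * cq 2 5 by apply: (lcomb 1 (poles 2 4 isT)%N); rewrite /=
  ?(y13, y44, q12); field_nat.
have q25 : cq 2 5 = 0 by apply: (lcomb 2%:R (poles 1 5 isT)%N); rewrite /= ?(y04, y13, y44,
  q12, y22); field_nat.
have y11 : cy 1 1 = 1 / 2%:R * cq 0 1 by apply: (lcomb (- 1) (poles 3 5 isT)%N); rewrite /=
  ?(y24, y33, q14); field_nat.
have y01 : cy 0 1 = cq 0 0 by apply: (lcomb (- 2%:R) (poles 0 5 isT)%N); rewrite /= ?(y14,
  y24, y45); field_nat.
have y03 : cy 0 3 = 1 / 4%:R * cy 1 2 - 1 / 4%:R * cq 0 2 by apply: (lcomb (1 / 2%:R) (poles
  2 5 isT)%N); rewrite /= ?(y34, y44); field_nat.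
have y02 : cy 0 2 = - 1 / 2%:R * cq 0 1 + 2%:R * cq 0 5 by apply: (lcomb (- 4%:R) (poles 0 4
  isT)%N); rewrite /= ?(y11, y24, y34); field_nat.
have y12 : cy 1 2 = - cq 0 2 + 8%:R * cq 5 5 by apply: (lcomb (- 16%:R) (poles 0 3
  isT)%N); rewrite /= ?(y03, y34, q11, q15); field_nat.
clear poles.
(* Third component in chart 2: once the known relations for [cy] and [cq] are substituted, the order
   is again 6 despite the factors [1/s] and [1/s^2]. *)
have poles m n (lt_n : (n < 6)%N) : lcoef [::
    [term 1 / 16%:R * cz 3 3, 0, 0]; [term 1 / 16%:R * cz 2 3, 0, 1];
    [term - 1 / 4%:R * cz 3 4, 2, 1];
    [term 1 / 8%:R * cz 1 3 + 1 / 16%:R * cz 2 2 - 3%:R / 4%:R * cq 5 5, 0, 2];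
    [term - 1 / 4%:R * cz 2 4 - cz 3 3 + 3%:R / 4%:R * cq 0 4, 2, 2];
    [term - 1 / 2%:R * cz 3 4, 3, 2]; [term cz 4 4, 4, 2];
    [term - 1 / 4%:R * cz 0 3 + 1 / 8%:R * cz 1 2 + 1 / 8%:R * t * cz 3 4
      - 3%:R / 8%:R * cq 0 1 + 3%:R / 4%:R * cq 0 5, 0, 3];
    [term - 1 / 4%:R * cz 1 3 - 3%:R / 8%:R * cq 0 2 + 3%:R * cq 5 5, 1, 3];
    [term - 1 / 2%:R * cz 1 4 - 3%:R / 4%:R * cz 2 3 + cz 4 5, 2, 3];
    [term - 1 / 2%:R * cz 2 4 - 1 / 2%:R * cz 3 3 + 3%:R / 2%:R * cq 0 4, 3, 3];
    [term cz 3 4, 4, 3]; [term 4%:R * cz 4 4, 5, 3];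
    [term - 1 / 4%:R * cz 0 2 + 1 / 4%:R * cz 1 1 + 1 / 8%:R * t * cz 2 4 + (- 1 / 8%:R
      - 1 / 4%:R * a) * cz 3 4 + 3%:R / 4%:R * cq 0 0 - 3%:R / 8%:R * t * cq 0 4, 0, 4];
    [term - 1 / 4%:R * cz 1 2 + 3%:R / 4%:R * cq 0 1, 1, 4];
    [term cz 0 4 - cz 1 3 - 1 / 2%:R * cz 2 2 - t * cz 4 4 + 3%:R / 4%:R * cq 0 2
      + 2%:R * cq 5 5, 2, 4];
    [term - 1 / 4%:R * cz 2 3 + 2%:R * cz 4 5, 3, 4]; [term 4%:R * cz 3 3 + cq 0 4, 4, 4];
    [term 5%:R * cz 3 4, 5, 4]; [term 12%:R * cz 4 4, 6, 4];
    [term - 2%:R * cy 0 0 - 1 / 2%:R * cz 0 1 + 1 / 4%:R * t * cz 1 4 + (- 1 / 8%:R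
      - 1 / 4%:R * a) * cz 2 4 - 1 / 2%:R * t * cz 4 5 + (3%:R / 8%:R + 3%:R / 4%:R * a) *
      cq 0 4, 0, 5];
    [term - cz 1 1 - 2%:R * cq 0 0, 1, 5];
    [term 2%:R * cz 0 3 - 1 / 2%:R * cz 1 2 - t * cz 3 4 + (1 + 2%:R * a) * cz 4 4 + cq 0 1
      - 6%:R * cq 0 5, 2, 5];
    [term 2%:R * cz 0 4 + 3%:R / 2%:R * cz 1 3 - 2%:R * t * cz 4 4 + 4%:R * cq 0 2
      - 28%:R * cq 5 5, 3, 5];
    [term 2%:R * cz 2 3 + 4%:R * cz 4 5, 4, 5];
    [term 2%:R * cz 2 4 + 4%:R * cz 3 3 - 4%:R * cq 0 4, 5, 5]; [term 10%:R * cz 3 4, 6, 5];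
    [term 16%:R * cz 4 4, 7, 5];
    [term cz 0 0 - 1 / 2%:R * t * cz 0 4 + (- 1 / 4%:R - 1 / 2%:R * a) * cz 1 4
      + 1 / 4%:R * t ^+ 2 * cz 4 4 + (1 / 2%:R + a) * cz 4 5, 0, 6];
    [term cz 0 1 - 1 / 2%:R * t * cz 1 4, 1, 6];
    [term cz 0 2 + cz 1 1 - 1 / 2%:R * t * cz 2 4 + (1 + 2%:R * a) * cz 3 4 - 2%:R * cq 0 0
      + t * cq 0 4, 2, 6];
    [term cz 0 3 + cz 1 2 - 1 / 2%:R * t * cz 3 4 + (2%:R + 4%:R * a) * cz 4 4
      - 2%:R * cq 0 1, 3, 6];
    [term 4%:R * cz 0 4 + cz 1 3 + cz 2 2 - 4%:R * t * cz 4 4 - 2%:R * cq 0 2, 4, 6];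
    [term 4%:R * cz 1 4 + cz 2 3, 5, 6];
    [term 4%:R * cz 2 4 + cz 3 3 - 8%:R * cq 0 4, 6, 6]; [term 4%:R * cz 3 4, 7, 6];
    [term 16%:R * cz 4 4, 8, 6];
    [term (1 / 2%:R + a) * cz 0 4 + (- 1 / 2%:R * t - t * a) * cz 4 4, 0, 7];
    [term (1 / 2%:R + a) * cz 1 4, 1, 7];
    [term (1 / 2%:R + a) * cz 2 4 + (- 1 - 2%:R * a) * cq 0 4, 2, 7];
    [term (1 / 2%:R + a) * cz 3 4, 3, 7]; [term (4%:R + 8%:R * a) * cz 4 4, 4, 7];
    [term (1 / 4%:R + a + a ^+ 2) * cz 4 4, 0, 8]] m n = 0.
  apply: (pole_coef natE (x := 'X) (y := 'X^2) (z := 'X^3) r2z) lt_n => u s s0.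
  rewrite !(hornerXn, hornerX) /quad_curve2 /quad
    ?(y05, y15, y25, y35, y55, z05, z15, z25, z35, z55,
    q44, q34, q33, q23, q24, q13, q45, q35, q03, y44, y34, y14, q14, y33, y23, y24, q11,
    y13, y45, q22, y22, q12, q15, y04, q25, y11, y01, y03, y02, y12) /=.
  by field; rewrite ?s0 ?natE.
have z44 : cz 4 4 = 0 by apply: (lcomb 1 (poles 4 2 isT)%N); rewrite /=; field_nat.
have z34 : cz 3 4 = 0 by apply: (lcomb 1 (poles 4 3 isT)%N); rewrite /=; field_nat.
have z33 : cz 3 3 = 0 by apply: (lcomb 16%:R (poles 0 0 isT)%N); rewrite /=; field_nat.
have z23 : cz 2 3 = 0 by apply: (lcomb 16%:R (poles 0 1 isT)%N); rewrite /=; field_nat.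
have z45 : cz 4 5 = 0 by apply: (lcomb (1 / 2%:R) (poles 3 4 isT)%N); rewrite /= z23;
  field_nat.
have z14 : cz 1 4 = 0 by apply: (lcomb (- 2%:R) (poles 2 3 isT)%N); rewrite /= ?(z23, z45);
  field_nat.
have q04 : cq 0 4 = 0 by apply: (lcomb 1 (poles 4 4 isT)%N); rewrite /= z33; field_nat.
have z24 : cz 2 4 = 0 by apply: (lcomb (- 2%:R) (poles 3 3 isT)%N); rewrite /= ?(z33, q04);
  field_nat.
have z11 : cz 1 1 = - 2%:R * cq 0 0 by apply: (lcomb (- 1) (poles 1 5 isT)%N); rewrite /=;
  field_nat.
have z12 : cz 1 2 = 3%:R * cq 0 1 by apply: (lcomb (- 4%:R) (poles 1 4 isT)%N); rewrite /=;
  field_nat.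
have z03 : cz 0 3 = 3%:R * cq 0 5 by apply: (lcomb (- 4%:R) (poles 0 3 isT)%N); rewrite /=
  ?(z12, z34); field_nat.
have q01 : cq 0 1 = 0 by apply: (lcomb (- 2%:R) (poles 2 5 isT)%N); rewrite /= ?(z03, z12,
  z34, z44); field_nat.
have y00 : cy 0 0 = - 1 / 4%:R * cz 0 1 by apply: (lcomb (- 1 / 2%:R) (poles 0 5
  isT)%N); rewrite /= ?(z14, z24, z45, q04); field_nat.
have z02 : cz 0 2 = cq 0 0 by apply: (lcomb (- 4%:R) (poles 0 4 isT)%N); rewrite /= ?(z11,
  z24, z34, q04); field_nat.
have z13 : cz 1 3 = - 3%:R / 2%:R * cq 0 2 + 12%:R * cq 5 5 by apply: (lcomb (- 4%:R) (poles
  1 3 isT)%N); rewrite /=; field_nat.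
have z22 : cz 2 2 = 3%:R * cq 0 2 - 12%:R * cq 5 5 by apply: (lcomb 16%:R (poles 0 2
  isT)%N); rewrite /= z13; field_nat.
have z04 : cz 0 4 = - 7%:R / 8%:R * cq 0 2 + 5%:R * cq 5 5 by apply: (lcomb (1 / 2%:R)
  (poles 3 5 isT)%N); rewrite /= ?(z13, z44); field_nat.
have q55 : cq 5 5 = 1 / 8%:R * cq 0 2 by apply: (lcomb 1 (poles 2 4 isT)%N); rewrite /=
  ?(z04, z13, z22, z44); field_nat.
clear poles.
(* First component in chart 2. With [y = 0] the coefficients [cx 2 j] remain visible, since the
   second coordinate of the curve is then [- q^2 / 4]. *)
have poles m n (lt_n : (n < 6)%N) : lcoef [::
    [term 1 / 16%:R * cx 3 3, 0, 0]; [term 1 / 16%:R * cx 2 3, 0, 1];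
    [term 1 / 8%:R * cx 1 3 + 1 / 16%:R * cx 2 2, 0, 2]; [term - 1 / 2%:R * cx 3 4, 2, 2];
    [term - 1 / 4%:R * cx 0 3 + 1 / 8%:R * cx 1 2 + 1 / 8%:R * t * cx 3 4, 0, 3];
    [term - 1 / 4%:R * cx 1 3, 1, 3]; [term - 1 / 2%:R * cx 2 4 - 1 / 2%:R * cx 3 3, 2, 3];
    [term - 1 / 4%:R * cx 0 2 + 1 / 4%:R * cx 1 1 + 1 / 8%:R * t * cx 2 4 + (- 1 / 8%:R
      - 1 / 4%:R * a) * cx 3 4 - 1 / 16%:R * cq 0 2, 0, 4];
    [term - 1 / 4%:R * cx 1 2, 1, 4];
    [term - cx 1 4 - 1 / 4%:R * cx 2 3 + 2%:R * cx 4 5, 2, 4]; [term 4%:R * cx 4 4, 4, 4];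
    [term - 1 / 2%:R * cx 0 1 + 1 / 4%:R * t * cx 1 4 + (- 1 / 8%:R - 1 / 4%:R * a) * cx 2 4
      - 1 / 2%:R * t * cx 4 5 + 1 / 2%:R * cq 0 5, 0, 5];
    [term - cx 1 1, 1, 5];
    [term 2%:R * cx 0 4 - 1 / 2%:R * cx 1 3 - 2%:R * t * cx 4 4, 2, 5];
    [term 2%:R * cx 1 4, 3, 5]; [term 2%:R * cx 3 4, 4, 5];
    [term cx 0 0 - 1 / 2%:R * t * cx 0 4 + (- 1 / 4%:R - 1 / 2%:R * a) * cx 1 4
      + 1 / 4%:R * t ^+ 2 * cx 4 4 + (1 / 2%:R + a) * cx 4 5 + 1 / 2%:R * cq 0 0, 0, 6];
    [term cx 0 1 - 1 / 2%:R * t * cx 1 4, 1, 6];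
    [term cx 0 3 + cx 1 1 - 1 / 2%:R * t * cx 3 4 + (2%:R + 4%:R * a) * cx 4 4, 2, 6];
    [term cx 1 3, 3, 6]; [term cx 3 3, 4, 6];
    [term (1 / 2%:R + a) * cx 0 4 + (- 1 / 2%:R * t - t * a) * cx 4 4, 0, 7];
    [term (1 / 2%:R + a) * cx 1 4, 1, 7]; [term (1 / 2%:R + a) * cx 3 4, 2, 7];
    [term (1 / 4%:R + a + a ^+ 2) * cx 4 4, 0, 8]] m n = 0.
  apply: (pole_coef natE (x := 'X) (y := 0) (z := 'X^2) r2x) lt_n => u s s0.
  rewrite !(hornerXn, hornerX, horner0) /quad_curve2 /quad
    ?(x05, x15, x25, x35, x55, y05, y15, y25,
    y35, y55, q44, q34, q33, q23, q24, q13, q45, q35, q03, y44, y34, y14, q14, y33, y23,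
    y24, q11, y13, y45, q22, y22, q12, q15, y04, q25, y11, y01, y03, y02, y12, q04, q01,
    y00, q55) /=.
  by field; rewrite ?s0 ?natE.
have x11 : cx 1 1 = 0 by apply: (lcomb (- 1) (poles 1 5 isT)%N); rewrite /=; field_nat.
have x34 : cx 3 4 = 0 by apply: (lcomb (- 2%:R) (poles 2 2 isT)%N); rewrite /=; field_nat.
have x14 : cx 1 4 = 0 by apply: (lcomb (1 / 2%:R) (poles 3 5 isT)%N); rewrite /=; field_nat.
have x13 : cx 1 3 = 0 by apply: (lcomb (- 4%:R) (poles 1 3 isT)%N); rewrite /=; field_nat.
have x12 : cx 1 2 = 0 by apply: (lcomb (- 4%:R) (poles 1 4 isT)%N); rewrite /=; field_nat.
have x44 : cx 4 4 = 0 by apply: (lcomb (1 / 4%:R) (poles 4 4 isT)%N); rewrite /=; field_nat.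
have x33 : cx 3 3 = 0 by apply: (lcomb 16%:R (poles 0 0 isT)%N); rewrite /=; field_nat.
have x23 : cx 2 3 = 0 by apply: (lcomb 16%:R (poles 0 1 isT)%N); rewrite /=; field_nat.
have x24 : cx 2 4 = 0 by apply: (lcomb (- 2%:R) (poles 2 3 isT)%N); rewrite /= x33;
  field_nat.
have x22 : cx 2 2 = 0 by apply: (lcomb 16%:R (poles 0 2 isT)%N); rewrite /= x13; field_nat.
have x45 : cx 4 5 = 0 by apply: (lcomb (1 / 2%:R) (poles 2 4 isT)%N); rewrite /= ?(x14,
  x23); field_nat.
have x04 : cx 0 4 = 0 by apply: (lcomb (1 / 2%:R) (poles 2 5 isT)%N); rewrite /= ?(x13,
  x44); field_nat.
have x03 : cx 0 3 = 0 by apply: (lcomb (- 4%:R) (poles 0 3 isT)%N); rewrite /= ?(x12, x34);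
  field_nat.
have x01 : cx 0 1 = cq 0 5 by apply: (lcomb (- 2%:R) (poles 0 5 isT)%N); rewrite /= ?(x14,
  x24, x45); field_nat.
have x02 : cx 0 2 = - 1 / 4%:R * cq 0 2 by apply: (lcomb (- 4%:R) (poles 0 4
  isT)%N); rewrite /= ?(x11, x24, x34); field_nat.
clear poles.
(* Fourth component in chart 2: the leading term comes from [z w], of order 4 when [y = 0], divided
   by [s^2]. *)
have poles m n (lt_n : (n < 6)%N) : lcoef [::
    [term 1 / 2%:R * cw 3 4, 2, 0];
    [term - 3%:R / 8%:R * cw 1 2 - 1 / 8%:R * t * cw 3 4, 0, 1];
    [term 1 / 2%:R * cw 2 4, 2, 1];
    [term - 1 / 4%:R * cz 0 1 - 1 / 8%:R * t * cw 2 4 + (1 / 8%:R + 1 / 4%:R * a) * cw 3 4,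
      0, 2];
    [term 1 / 4%:R * cw 1 2 + cq 0 0, 1, 2];
    [term cw 1 4 - 2%:R * cw 4 5 - 1 / 2%:R * cq 0 2, 2, 2]; [term - 4%:R * cw 4 4, 4, 2];
    [term 2%:R * cz 0 0 - 1 / 4%:R * t * cw 1 4 + (1 / 8%:R + 1 / 4%:R * a) * cw 2 4
      + 1 / 2%:R * t * cw 4 5 + 1 / 4%:R * t * cq 0 2, 0, 3];
    [term 2%:R * cz 0 1, 1, 3];
    [term - 2%:R * cw 0 4 + 2%:R * t * cw 4 4 - 4%:R * cq 0 0 + 8%:R * cq 0 5, 2, 3];
    [term - 2%:R * cw 1 4, 3, 3]; [term - 2%:R * cw 3 4, 4, 3];
    [term 1 / 2%:R * t * cw 0 4 + (1 / 4%:R + 1 / 2%:R * a) * cw 1 4 - 1 / 4%:R * t ^+ 2 *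
      cw 4 4 - 2%:R * a * cw 4 5 + (- 1 / 8%:R - 1 / 2%:R * a) * cq 0 2 - 1 / 2%:R, 0, 4];
    [term 1 / 2%:R * t * cw 1 4, 1, 4];
    [term cw 1 2 + 1 / 2%:R * t * cw 3 4 + (- 2%:R - 4%:R * a) * cw 4 4 + 2%:R * cq 0 0, 2,
      4];
    [term (- 1 / 2%:R - a) * cw 0 4 + (1 / 2%:R * t + t * a) * cw 4 4 + (- 1 / 2%:R - a) *
      cq 0 5, 0, 5];
    [term (- 1 / 2%:R - a) * cw 1 4, 1, 5]; [term (- 1 / 2%:R - a) * cw 3 4, 2, 5];
    [term (- 1 / 4%:R - a - a ^+ 2) * cw 4 4 + (- 1 / 2%:R - a) * cq 0 0, 0, 6]] m n = 0.
  apply: (pole_coef natE (x := 'X) (y := 0) (z := 'X^2) r2w) lt_n => u s s0.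
  rewrite !(hornerXn, hornerX, horner0) /quad_curve2 /quad
    ?(y05, y15, y25, y35, y55, z05, z15, z25,
    z35, z55, w55, w05, w15, w01, w11, w25, w02, w35, w13, w22, w23, w33, w03, w00, q44,
    q34, q33, q23, q24, q13, q45, q35, q03, y44, y34, y14, q14, y33, y23, y24, q11, y13,
    y45, q22, y22, q12, q15, y04, q25, y11, y01, y03, y02, y12, z44, z34, z33, z23, z45,
    z14, q04, z24, z11, z12, z03, q01, y00, z02, z13, z22, z04, q55) /=.
  by field; rewrite ?s0 ?natE.
have z01 : cz 0 1 = 0 by apply: (lcomb (1 / 2%:R) (poles 1 3 isT)%N); rewrite /=; field_nat.
have w34 : cw 3 4 = 0 by apply: (lcomb 2%:R (poles 2 0 isT)%N); rewrite /=; field_nat.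
have w24 : cw 2 4 = 0 by apply: (lcomb 2%:R (poles 2 1 isT)%N); rewrite /=; field_nat.
have w14 : cw 1 4 = 0 by apply: (lcomb (- 1 / 2%:R) (poles 3 3 isT)%N); rewrite /=;
  field_nat.
have w44 : cw 4 4 = 0 by apply: (lcomb (- 1 / 4%:R) (poles 4 2 isT)%N); rewrite /=;
  field_nat.
have w12 : cw 1 2 = 0 by apply: (lcomb (- 8%:R / 3%:R) (poles 0 1 isT)%N); rewrite /= w34;
  field_nat.
have q00 : cq 0 0 = 0 by apply: (lcomb 1 (poles 1 2 isT)%N); rewrite /= w12; field_nat.
have w45 : cw 4 5 = - 1 / 4%:R * cq 0 2 by apply: (lcomb (- 1 / 2%:R) (poles 2 2
  isT)%N); rewrite /= w14; field_nat.
have w04 : cw 0 4 = 4%:R * cq 0 5 by apply: (lcomb (- 1 / 2%:R) (poles 2 3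
  isT)%N); rewrite /= ?(w44, q00); field_nat.
have z00 : cz 0 0 = - 1 / 16%:R * t * cq 0 2 by apply: (lcomb (1 / 2%:R) (poles 0 3
  isT)%N); rewrite /= ?(w14, w24, w45); field_nat.
(* The one inhomogeneous equation: its [1/2], the derivative of [t / 2], fixes the scale of the
   solution. The terms in [a] cancel. *)
have q02 : cq 0 2 = 16%:R * t * cq 0 5 - 4%:R by apply: (lcomb (- 8%:R) (poles 0 4
  isT)%N); rewrite /= ?(w04, w14, w44, w45); field_nat.
(* The charts give [(a - 1/2)(w04 + q05) = 0] and [(a + 1/2)(w04 + q05) = 0]; the
   difference is free of [a]. *)
have q05 : cq 0 5 = 0.
  apply: (lcomb (- 1 / 5%:R) (poles 0 5 isT)%N); apply: (lcomb (- 1 / 5%:R) w04q05).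
  by rewrite /= w04 w44; field_nat.
(* Back substitution. [cx 0 0] occurs in no polar coefficient and stays free. *)
have {}w03 : cw 0 3 = 0 by rewrite w03 w12; field_nat.
have {}q45 : cq 4 5 = 0 by rewrite q45 q14; field_nat.
have {}q35 : cq 3 5 = 0 by rewrite q35 q22; field_nat.
have {}q03 : cq 0 3 = 0 by rewrite q03 q12 q25; field_nat.
have {}y45 : cy 4 5 = 0 by rewrite y45 q04; field_nat.
have {}y22 : cy 2 2 = 0 by rewrite y22 q12; field_nat.
have {}y13 : cy 1 3 = 0 by rewrite y13 y22; field_nat.
have {}y04 : cy 0 4 = 0 by rewrite y04 q25; field_nat.
have {}y11 : cy 1 1 = 0 by rewrite y11 q01; field_nat.
have {}y01 : cy 0 1 = 0 by rewrite y01 q00; field_nat.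
have {}y02 : cy 0 2 = 0 by rewrite y02 q01 q05; field_nat.
have {}z11 : cz 1 1 = 0 by rewrite z11 q00; field_nat.
have {}z12 : cz 1 2 = 0 by rewrite z12 q01; field_nat.
have {}z03 : cz 0 3 = 0 by rewrite z03 q05; field_nat.
have {}y00 : cy 0 0 = 0 by rewrite y00 z01; field_nat.
have {}z02 : cz 0 2 = 0 by rewrite z02 q00; field_nat.
have {}x01 : cx 0 1 = 0 by rewrite x01 q05; field_nat.
have {}w04 : cw 0 4 = 0 by rewrite w04 q05; field_nat.
have {}q02 : cq 0 2 = - 4%:R by rewrite q02 q05; field_nat.
have {}q55 : cq 5 5 = - 2%:R^-1 by rewrite q55 q02; field_nat.
have {}y12 : cy 1 2 = 0 by rewrite y12 q02 q55; field_nat.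
have {}q15 : cq 1 5 = 0 by rewrite q15 y12; field_nat.
have {}y03 : cy 0 3 = 1 by rewrite y03 y12 q02; field_nat.
have {}z13 : cz 1 3 = 0 by rewrite z13 q02 q55; field_nat.
have {}z22 : cz 2 2 = - 6%:R by rewrite z22 q55 q02; field_nat.
have {}z04 : cz 0 4 = 1 by rewrite z04 q02 q55; field_nat.
have {}x02 : cx 0 2 = 1 by rewrite x02 q02; field_nat.
have {}w45 : cw 4 5 = 1 by rewrite w45 q02; field_nat.
have {}w00 : cw 0 0 = (2%:R * a - 1) / 4%:R by rewrite w00 w45 q55; field_nat.
have {}z00 : cz 0 0 = t / 4%:R by rewrite z00 q02; field_nat.
split; rewrite /mquad /quad.
- by rewrite !(x05, x15, x25, x35, x55, x11, x34, x14, x13, x12, x44, x33, x23, x24, x22,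
    x45, x04, x03, x01, x02) !(mpolyC0, mpolyC1, mul0r, mul1r, addr0) addrC.
- by rewrite !(y05, y15, y25, y35, y55, y44, y34, y14, y33, y23, y24, y13, y45, y22, y04,
    y11, y01, y03, y02, y12, y00) !(mpolyC0, mpolyC1, mul0r, mul1r, addr0, add0r).
- rewrite !(z05, z15, z25, z35, z55, z44, z34, z33, z23, z45, z14, z24, z11, z12, z03, z02,
    z13, z22, z04, z01, z00) !(mpolyC0, mpolyC1, mul0r, mul1r, addr0).
  by rewrite mpolyCN mpolyC_nat -addrA addrC [_ + 'X_ _]addrC.
- by rewrite !(w55, w05, w15, w01, w11, w25, w02, w35, w13, w22, w23, w33, w03, w00, w34,
    w24, w14, w44, w12, w45, w04) !(mpolyC0, mpolyC1, mul0r, mul1r, addr0) addrC.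
- rewrite !(q44, q34, q33, q23, q24, q13, q45, q35, q03, q14, q11, q22, q12, q15, q25, q04,
    q01, q55, q00, q02, q05) !(mpolyC0, mul0r, addr0, add0r) addrC.
  by rewrite !mpolyCN mpolyC_nat !mulNr.
Qed.

End Coefficients.

(** * Quadratic systems over an abstract differential field *)

Section System.
Variables (E : fieldType) (dE : {additive E -> E}).
Hypothesis dEM : forall a b, dE (a * b) = dE a * b + a * dE b.
Hypothesis natE : forall n, n.+1%:R != 0 :> E.
Variables t a : E.
Hypotheses (dEt : dE t = 1) (dEa : dE a = 0).
Variable f : 'I_5 -> {mpoly E[5]}.

Lemma quadratic_system :
  (forall i, msize (f i) <= 3)%N ->
  polynomial_in_chart dE f (chart1 a) -> polynomial_in_chart dE f (chart2 t a) ->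
  exists g : E,
    [/\ f (inord 0) = 'X_(inord 1) + g%:MP,
        f (inord 1) = 'X_(inord 2),
        f (inord 2) = - 6%:R * 'X_(inord 1) ^+ 2 + 'X_(inord 3) + (t / 4%:R)%:MP,
        f (inord 3) = 'X_(inord 3) * 'X_(inord 4) + ((2%:R * a - 1) / 4%:R)%:MP
      & f (inord 4) = - (2%:R^-1 : E)%:MP * 'X_(inord 4) ^+ 2 - 4%:R * 'X_(inord 1)].
Proof.
move=> deg_f /(chart1_regular dEM natE dEa) [r1x r1y r1z r1w].
move=> /(chart2_regular dEM natE dEt dEa) [r2x r2y r2z r2w r2q].
have [[cx fx] [cy fy]] := (mquad_exists (deg_f (inord 0)), mquad_exists (deg_f (inord 1))).
have [[cz fz] [cw fw]] := (mquad_exists (deg_f (inord 2)), mquad_exists (deg_f (inord 3))).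
have [cq fq] := mquad_exists (deg_f (inord 4)).
exists (cx 0 0)%N; rewrite fx fy fz fw fq.
apply: (regular_coefficients natE).
- by apply: (eq_regular r1x) => x y z s _; rewrite fx meval_mquad.
- by apply: (eq_regular r1y) => x y z s _; rewrite fy meval_mquad.
- by apply: (eq_regular r1z) => x y z s _; rewrite fz meval_mquad.
- by apply: (eq_regular r1w) => x y z s _; rewrite fw fq !meval_mquad.
- by apply: (eq_regular r2x) => x y z s _; rewrite fx fq !meval_mquad.
- by apply: (eq_regular r2y) => x y z s _; rewrite fy fq !meval_mquad.
- by apply: (eq_regular r2z) => x y z s _; rewrite fy fz fq !meval_mquad.
- by apply: (eq_regular r2w) => x y z s _; rewrite fy fz fw fq !meval_mquad.
- by apply: (eq_regular r2q) => x y z s _; rewrite fq !meval_mquad.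
Qed.

End System.

(** * The differential field of rational functions in t *)

Lemma derKD : {morph derK : u v / u + v}.
Proof. exact: (fderivD (@derivM _) (@derivD _)). Qed.

Lemma derKM u v : derK (u * v) = derK u * v + u * derK v.
Proof. exact: (fderivM (@derivM _)). Qed.

Lemma derK_tK : derK tK = 1.
Proof. by rewrite [LHS](fderiv_tofrac (@derivM _)) derivX tofrac1. Qed.

Lemma derK_cK c : derK (cK c) = 0.
Proof. by rewrite [LHS](fderiv_tofrac (@derivM _)) derivC tofrac0. Qed.

Lemma derK_is_zmod_morphism : zmod_morphism derK.
Proof. by move=> u v; rewrite derKD (derivationN derKD). Qed.

HB.instance Definition _ := GRing.isZmodMorphism.Build K K derK derK_is_zmod_morphism.

Lemma natK_neq0 n : n.+1%:R != 0 :> K.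
Proof.
rewrite -[1 : K]/(1%:F) -tofracMn tofrac_eq0 -polyC_natr polyC_eq0.
by rewrite (@Num.Theory.pnatr_eq0 (complex Rdefinitions.R)).
Qed.

Unset Implicit Arguments.

Theorem theorem9p3 (alpha2 : C) (f : 'I_5 -> MP) :
  (* (A1) the system has degree 2 in x,y,z,w,q *)
  (forall i : 'I_5, (msize (f i) <= 3)%N) ->
  (exists i : 'I_5, msize (f i) = 3%N) ->
  (* (A2) polynomiality in the coordinate systems r1, r2, r3 *)
  polynomial_in_coords f (r1 alpha2) ->
  polynomial_in_coords f (r2 alpha2) ->
  polynomial_in_coords f (r3 alpha2) ->
  exists g : K,
    [/\ f (inord 0) = var 1 + g%:MP,
        f (inord 1) = var 2,
        f (inord 2) = - 6%:R * var 1 ^+ 2 + var 3 + (tK / 4%:R)%:MP,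
        f (inord 3) = var 3 * var 4 + ((2%:R * cK alpha2 - 1) / 4%:R)%:MP
      & f (inord 4) = - (2%:R^-1 : K)%:MP * var 4 ^+ 2 - 4%:R * var 1].
Proof.
move=> deg_f _ poly1 poly2 _.
(* Over [K] the abstract charts and the polynomiality condition unfold to [r1], [r2] and
   [polynomial_in_coords]. *)
exact: (@quadratic_system K derK derKM natK_neq0 tK (cK alpha2) derK_tK (derK_cK alpha2)
  f deg_f poly1 poly2).
Qed.
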